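(* Let $X\in\mathbb{R}^D$ be a sub-Gaussian random vector with covariance $\Sigma$, let $X_1,\dots,X_N$ be independent copies of $X$ and $\hat\Sigma$ the sample covariance. Let $A\in\mathbb{R}^{d_1\times D}$, $B\in\mathbb{R}^{d_2\times D}$. (i) Assume $\|A\tilde X\|_2\le C_A$ and $\|B\tilde X\|_2\le C_B$ almost surely. Then for any $u>0$, with probability at least $1-\exp(-u)$, $$\|A(\hat\Sigma-\Sigma)B^\top\|_F\lesssim C_AC_B\sqrt{\frac{1+u}{N}}.$$ (ii) Assume $\|A\Sigma^\dagger\tilde X\|_2\le C_A^\dagger$, $\|B\Sigma^\dagger\tilde X\|_2\le C_B^\dagger$ and $\|\sqrt{\Sigma^\dagger}\tilde X\|_2^2\le\Theta$ almost surely. There exists $C>0$ such that for any $u>0$, provided $N>C(1+u)\Theta^2$, with probability at least $1-\exp(-u)$, $$\|A(\hat\Sigma^\dagger-\Sigma^\dagger)B^\top\|_F\lesssim C_A^\dagger C_B^\dagger\sqrt{\frac{1+u}{N}}.$$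
   Context: $\tilde X:=X-\mathbb{E}X$, $\Sigma=\mathbb{E}\tilde X\tilde X^\top$, $\hat\mu_X:=N^{-1}\sum_iX_i$, $\hat\Sigma:=N^{-1}\sum_i(X_i-\hat\mu_X)(X_i-\hat\mu_X)^\top$. $\|\cdot\|_F$ is the Frobenius norm, $\|\cdot\|_2$ the Euclidean norm of vectors. $M^\dagger$ is the Moore–Penrose pseudoinverse, $\sqrt{\Sigma^\dagger}$ its PSD square root. $a\lesssim b$ means $a\le C'b$ for a universal constant $C'>0$. *)

(* Defs.v *)
From HB Require Import structures.
From mathcomp Require Import all_boot all_order all_algebra.
From mathcomp Require Import all_classical all_reals all_analysis.
From Stdlib Require Import ClassicalEpsilon.
Set Implicit Arguments. Unset Strict Implicit. Unset Printing Implicit Defensive.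
Import Order.TTheory GRing.Theory Num.Theory.
Local Open Scope classical_set_scope.
Local Open Scope ring_scope.

Section Defs.
Variable R : realType.

Definition vnorm2 (n : nat) (v : 'cV[R]_n) : R :=
  Num.sqrt (\sum_(i < n) v i 0 ^+ 2).

Definition frob (m n : nat) (M : 'M[R]_(m, n)) : R :=
  Num.sqrt (\sum_(i < m) \sum_(j < n) M i j ^+ 2).

Definition penrose (m n : nat) (M : 'M[R]_(m, n)) (Mp : 'M[R]_(n, m)) : Prop :=
  [/\ M *m Mp *m M = M, Mp *m M *m Mp = Mp,
      (M *m Mp)^T = M *m Mp & (Mp *m M)^T = Mp *m M].

(* The Moore-Penrose pseudoinverse (exists and is unique; chosen by epsilon) *)
Definition mpinv (m n : nat) (M : 'M[R]_(m, n)) : 'M[R]_(n, m) :=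
  epsilon (inhabits 0) (penrose M).

Definition psd (n : nat) (M : 'M[R]_n) : Prop :=
  M^T = M /\ forall v : 'cV[R]_n, 0 <= (v^T *m M *m v) 0 0.

(* PSD square root of a PSD matrix: the unique PSD S with S * S = M *)
Definition psd_sqrt (n : nat) (M : 'M[R]_n) : 'M[R]_n :=
  epsilon (inhabits 0) (fun S => psd S /\ S *m S = M).

Context d (T : measurableType d) (P : probability T R).

(* Expectation of a real random variable (assumed integrable where used) *)
Definition expect (f : T -> R) : R := fine (\int[P]_x (f x)%:E).

Definition meanv (D : nat) (X : T -> 'cV[R]_D) : 'cV[R]_D :=
  \col_k expect (fun x => X x k 0).

Definition centered (D : nat) (X : T -> 'cV[R]_D) (x : T) : 'cV[R]_D :=
  X x - meanv X.

Definition covmx (D : nat) (X : T -> 'cV[R]_D) : 'M[R]_D :=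
  \matrix_(i, j) expect (fun x => centered X x i 0 * centered X x j 0).

Definition sample_mean (D N : nat) (Xs : 'I_N -> T -> 'cV[R]_D) (x : T)
  : 'cV[R]_D := N%:R^-1 *: \sum_(i < N) Xs i x.

Definition sample_cov (D N : nat) (Xs : 'I_N -> T -> 'cV[R]_D) (x : T)
  : 'M[R]_D :=
  N%:R^-1 *: \sum_(i < N)
     ((Xs i x - sample_mean Xs x) *m (Xs i x - sample_mean Xs x)^T).

Definition random_vector (D : nat) (X : T -> 'cV[R]_D) : Prop :=
  forall k : 'I_D, measurable_fun setT (fun x => X x k 0).

Definition subgaussian (D : nat) (X : T -> 'cV[R]_D) : Prop :=
  (forall k : 'I_D, P.-integrable setT (fun x => (X x k 0)%:E)) /\
  exists K : R, 0 < K /\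
    forall v : 'cV[R]_D, vnorm2 v = 1 ->
      (\int[P]_x (expR (((v^T *m centered X x) 0 0) ^+ 2 / K ^+ 2))%:E
        <= 2%:E)%E.

(* Y has the same law as X: agreement on all measurable rectangles of R^D
   (a pi-system generating the Borel sigma-algebra of R^D) *)
Definition same_law (D : nat) (Y X : T -> 'cV[R]_D) : Prop :=
  forall B : 'I_D -> set R, (forall k, measurable (B k)) ->
    P [set x | forall k, B k (Y x k 0)] = P [set x | forall k, B k (X x k 0)].

(* mutual independence of the random vectors Xs i, tested on measurable
   rectangles (a pi-system generating each sigma(Xs i)) *)
Definition mutually_independent (D N : nat) (Xs : 'I_N -> T -> 'cV[R]_D)
  : Prop :=
  forall B : 'I_N -> 'I_D -> set R, (forall i k, measurable (B i k)) ->
    P [set x | forall i k, B i k (Xs i x k ord0)] =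
    (\prod_(i < N) P [set x | forall k, B i k (Xs i x k ord0)])%E.

End Defs.

(* Main.v *)
(* The heart is a dimension-free Hoeffding inequality for bounded martingale
   differences W_k in R^J. With |W_k| <= 1 and S_k the partial sums, expanding
   |S_k + W_{k+1}|^2 and bounding the cross term by e^x <= x + e^(2x^2) gives
     E exp(s |S_{k+1}|^2) <= e^s E exp((s + 8 s^2) |S_k|^2),
   because the linear term has mean zero; the weights s_k = 1/(8(N + k)) close
   this recursion and leave E exp(|S_N|^2 / (16 N)) <= e^(1/8).

   For (i), with Z_i = X_i - E X and m the mean of the Z_i,
     A (Shat - Sigma) B^T = (mean of (A Z_i)(B Z_i)^T - A Sigma B^T) - (A m)(B m)^T,
   and the inequality is applied to (A Z)(B Z)^T and to B Z.

   For (ii), put S = sqrt(Sigma^+), E = Shat - Sigma and K = 1 + S E S. Almost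
   surely the sample lives in the range of Sigma, so that Shat^+ = S K^-1 S as
   soon as |S E S| <= 1/2, whence
     A (Shat^+ - Sigma^+) B^T
       = - A Sigma^+ E Sigma^+ B^T + (A Sigma^+ E S) K^-1 (S E Sigma^+ B^T),
   and (i) is applied to the four pairs formed with A Sigma^+, B Sigma^+ and S. *)
Require Import Defs.
From HB Require Import structures.
From mathcomp Require Import all_boot all_order all_algebra.
From mathcomp Require Import all_classical all_reals all_analysis.
From mathcomp Require Import measurable_realfun ring lra complex.
From Stdlib Require Import ClassicalEpsilon.
Set Implicit Arguments. Unset Strict Implicit. Unset Printing Implicit Defensive.
Import Order.TTheory GRing.Theory Num.Theory.
Import numFieldNormedType.Exports.
Local Open Scope classical_set_scope.
Local Open Scope ring_scope.

(** * Euclidean and Frobenius norms, pseudoinverse *)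

(** Dimension-free constants force a matrix to be treated as one vector of R^(d1 d2) with its
    Frobenius norm: a covering or an entrywise union bound would cost a dimension. The norm |S_k| is
    not a martingale, so exponential moments of |S_k|^2 are propagated instead; each step back from
    k + 1 to k inflates the coefficient of the square, which therefore has to shrink as k grows. In
    (i) the rank-one correction needs concentration of one factor only, since |A m| <= C_A holds
    almost surely. In (ii) the inverse of K sits between two deviations, whose product carries a
    factor Theta sqrt((1 + u) / N). The condition on N bounds this factor by 1/128, which both makes
    K invertible and absorbs the quadratic term into the linear one. Equality in law and
    independence are given on rectangles; uniqueness of measures on pi-systems carries them to the
    sigma-algebras. *)

Section Euclidean.
Variables (R : realType) (J : finType).
Implicit Types f g : J -> R.

Lemma cauchy_schwarz f g :
  (\sum_j f j * g j) ^+ 2 <= (\sum_j f j ^+ 2) * (\sum_j g j ^+ 2).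
Proof.
set a := \sum_j f j ^+ 2; set b := \sum_j g j ^+ 2; set c := \sum_j f j * g j.
have b0 : 0 <= b by apply: sumr_ge0 => j _; exact: sqr_ge0.
have disc t : 0 <= a - (t * c) *+ 2 + t ^+ 2 * b.
  suff -> : a - (t * c) *+ 2 + t ^+ 2 * b = \sum_j (f j - t * g j) ^+ 2.
    by apply: sumr_ge0 => j _; exact: sqr_ge0.
  rewrite /a /b /c !mulr_sumr -sumrMnl -sumrN -!big_split/=.
  by apply: eq_bigr => j _; ring.
have [b_eq0|b_neq0] := eqVneq b 0.
  have gj0 j : g j = 0.
    move: (b_eq0) => /eqP; rewrite psumr_eq0 => [/allP/(_ j)|i _]; last exact: sqr_ge0.
    by rewrite mem_index_enum sqrf_eq0 => /(_ isT)/eqP.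
  have -> : c = 0 by rewrite /c big1// => j _; rewrite gj0 mulr0.
  by rewrite b_eq0 mulr0 expr0n.
have := disc (c / b).
have -> : a - (c / b * c) *+ 2 + (c / b) ^+ 2 * b = a - c ^+ 2 / b by field.
by rewrite subr_ge0 ler_pdivrMr ?lt0r ?b_neq0.
Qed.

(** Indexed by any finite type, so that vectors and matrices (indexed by pairs) share one theory,
    and so that the concentration inequality applies to both. *)
Definition l2norm f : R := Num.sqrt (\sum_j f j ^+ 2).

Lemma l2norm_ge0 f : 0 <= l2norm f. Proof. exact: sqrtr_ge0. Qed.

Lemma sqr_l2norm f : l2norm f ^+ 2 = \sum_j f j ^+ 2.
Proof. by rewrite sqr_sqrtr//; apply: sumr_ge0 => j _; exact: sqr_ge0. Qed.

Lemma l2norm_le f r : 0 <= r -> (l2norm f <= r) = (\sum_j f j ^+ 2 <= r ^+ 2).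
Proof.
by move=> r0; rewrite -sqr_l2norm ler_pXn2r// nnegrE l2norm_ge0.
Qed.

Lemma ler_dot f g : \sum_j f j * g j <= l2norm f * l2norm g.
Proof.
apply: le_trans (ler_norm _) _.
rewrite -(@ler_pXn2r _ 2%N)// ?nnegrE// ?mulr_ge0 ?l2norm_ge0//.
by rewrite real_normK ?num_real// exprMn !sqr_l2norm cauchy_schwarz.
Qed.

Lemma l2normD f g : l2norm (fun j => f j + g j) <= l2norm f + l2norm g.
Proof.
rewrite l2norm_le ?addr_ge0 ?l2norm_ge0//.
rewrite sqrrD !sqr_l2norm.
have -> : \sum_j (f j + g j) ^+ 2 =
    \sum_j f j ^+ 2 + (\sum_j f j * g j) *+ 2 + \sum_j g j ^+ 2.
  by rewrite -sumrMnl -!big_split/=; apply: eq_bigr => j _; rewrite sqrrD.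
by rewrite lerD2r lerD2l lerMn2r ler_dot.
Qed.

End Euclidean.

Section FrobeniusNorm.
Variable R : realType.

Lemma frobE m n (M : 'M[R]_(m, n)) :
  frob M = l2norm (fun p : 'I_m * 'I_n => M p.1 p.2).
Proof. by rewrite /frob /l2norm pair_big. Qed.

Lemma frob_ge0 m n (M : 'M[R]_(m, n)) : 0 <= frob M.
Proof. exact: sqrtr_ge0. Qed.

Lemma frobD m n (M N : 'M[R]_(m, n)) : frob (M + N) <= frob M + frob N.
Proof.
rewrite !frobE; apply: le_trans (l2normD _ _).
by rewrite /l2norm; under eq_bigr do rewrite mxE.
Qed.

Lemma frobN m n (M : 'M[R]_(m, n)) : frob (- M) = frob M.
Proof. by rewrite /frob; under eq_bigr do under eq_bigr do rewrite mxE sqrrN. Qed.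

Lemma sqr_frob m n (M : 'M[R]_(m, n)) :
  frob M ^+ 2 = \sum_i \sum_j M i j ^+ 2.
Proof. by rewrite frobE sqr_l2norm -(pair_big xpredT xpredT (fun i j => M i j ^+ 2)). Qed.

(** Cauchy-Schwarz on each entry. This lets the Frobenius norm play the role of an operator norm
    throughout. *)
Lemma frobM m n p (M : 'M[R]_(m, n)) (N : 'M[R]_(n, p)) :
  frob (M *m N) <= frob M * frob N.
Proof.
rewrite -(@ler_pXn2r _ 2%N)// ?nnegrE// ?mulr_ge0 ?frob_ge0//.
rewrite exprMn !sqr_frob mulr_suml; apply: ler_sum => i _.
rewrite [X in _ * X]exchange_big/= mulr_sumr; apply: ler_sum => k _.
by rewrite mxE; exact: cauchy_schwarz.
Qed.

Lemma frob_eq0 m n (M : 'M[R]_(m, n)) : frob M = 0 -> M = 0.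
Proof.
move=> M0; have /eqP := sqr_frob M; rewrite M0 expr0n/= eq_sym.
rewrite psumr_eq0 => [/allP Mi0|i _]; last by apply: sumr_ge0 => j _; exact: sqr_ge0.
apply/matrixP => i j; have /eqP := Mi0 i (mem_index_enum _).
move/eqP; rewrite psumr_eq0 => [/allP/(_ j (mem_index_enum _))|k _]; last exact: sqr_ge0.
by rewrite mxE sqrf_eq0 => /eqP.
Qed.

(** The diagonal entries of the product are the squared norms of the rows. This positivity fact
    yields kernel and range statements without spectral theory. *)
Lemma mulmx_tr_eq0 m n (M : 'M[R]_(m, n)) : M *m M^T = 0 -> M = 0.
Proof.
move=> MM; apply: frob_eq0; apply/eqP; rewrite -sqrf_eq0 sqr_frob; apply/eqP.
rewrite big1// => i _; have := congr1 (fun A : 'M[R]_m => A i i) MM.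
by rewrite !mxE; apply: etrans; apply: eq_bigr => j _; rewrite mxE expr2.
Qed.

Lemma frob_outer m n (v : 'cV[R]_m) (w : 'cV[R]_n) :
  frob (v *m w^T) = vnorm2 v * vnorm2 w.
Proof.
rewrite /vnorm2 -sqrtrM ?sumr_ge0// => [|i _]; last exact: sqr_ge0.
congr Num.sqrt; rewrite mulr_suml; apply: eq_bigr => i _.
by rewrite mulr_sumr; apply: eq_bigr => j _; rewrite !mxE big_ord1 mxE exprMn.
Qed.

Lemma vnorm2_ge0 n (v : 'cV[R]_n) : 0 <= vnorm2 v. Proof. exact: sqrtr_ge0. Qed.

Lemma vnorm2E n (v : 'cV[R]_n) : vnorm2 v = l2norm (fun i => v i 0).
Proof. by []. Qed.

Lemma vnorm2D n (v w : 'cV[R]_n) : vnorm2 (v + w) <= vnorm2 v + vnorm2 w.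
Proof.
rewrite !vnorm2E; apply: le_trans (l2normD _ _).
by rewrite le_eqVlt; apply/orP; left; apply/eqP; congr Num.sqrt;
  apply: eq_bigr => i _; rewrite mxE.
Qed.

(* The bound is read off the fixed-point equation Z = Y - G Z for Z = (1 + G)^-1 Y. *)
Lemma frob_invmx1D n p (G : 'M[R]_n) (Y : 'M[R]_(n, p)) : frob G <= 2^-1 ->
  1%:M + G \in unitmx /\ frob (invmx (1%:M + G) *m Y) <= 2 * frob Y.
Proof.
move=> G2; have bnd q (Z : 'M[R]_(n, q)) : frob Z <= 2 * frob ((1%:M + G) *m Z).
  have Zeq : Z = (1%:M + G) *m Z + - (G *m Z) by rewrite mulmxDl mul1mx addrK.
  have := frobD ((1%:M + G) *m Z) (- (G *m Z)); rewrite -Zeq frobN.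
  have := frobM G Z; have := frob_ge0 Z; have := frob_ge0 ((1%:M + G) *m Z).
  have := ler_wpM2r (frob_ge0 Z) G2; lra.
(* The same bound gives injectivity: it is applied to a matrix whose columns span the kernel of 1 +
   G, and whose image is therefore 0. *)
have uK : 1%:M + G \in unitmx.
  rewrite -unitmx_tr -row_free_unit -kermx_eq0; apply/eqP/trmx_inj.
  rewrite trmx0; apply: frob_eq0; apply/eqP; rewrite eq_le frob_ge0 andbT.
  apply: le_trans (bnd _ _) _.
  have -> : (1%:M + G) *m (kermx (1%:M + G)^T)^T = 0.
    by rewrite -[1%:M + G]trmxK -trmx_mul trmxK mulmx_ker trmx0.
  by rewrite /frob big1 ?sqrtr0 ?mulr0// => i _; rewrite big1// => j _; rewrite mxE expr0n.
split=> //; apply: le_trans (bnd _ _) _.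
by rewrite mulmxA mulmxV// mul1mx.
Qed.

End FrobeniusNorm.

Section Pseudoinverse.
Variable R : realType.

Lemma unitmx_gram m n (M : 'M[R]_(m, n)) : row_free M -> M *m M^T \in unitmx.
Proof.
move=> freeM; rewrite -row_free_unit -kermx_eq0; apply/eqP.
have kM : kermx (M *m M^T) *m M = 0.
  apply: mulmx_tr_eq0; rewrite trmx_mul mulmxA -[_ *m M *m M^T]mulmxA mulmx_ker.
  by rewrite mul0mx.
by apply: (row_free_inj freeM); rewrite kM mul0mx.
Qed.

(** MacDuffee's formula for a full-rank factorisation. The two products of [C *m Q] with the
    candidate collapse to the orthogonal projections onto the column space of [C] and the row space
    of [Q]. *)
Lemma penrose_full_rank m r n (C : 'M[R]_(m, r)) (Q : 'M[R]_(r, n)) :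
    row_free C^T -> row_free Q ->
  penrose (C *m Q)
    (Q^T *m invmx (Q *m Q^T) *m invmx (C^T *m C) *m C^T).
Proof.
move=> freeC freeQ.
have uQ : Q *m Q^T \in unitmx by exact: unitmx_gram.
have uC : C^T *m C \in unitmx.
  by rewrite -[X in _ *m X]trmxK; apply: unitmx_gram.
have symQ : (invmx (Q *m Q^T))^T = invmx (Q *m Q^T).
  by rewrite trmx_inv trmx_mul trmxK.
have symC : (invmx (C^T *m C))^T = invmx (C^T *m C).
  by rewrite trmx_inv trmx_mul trmxK.
set iQ := invmx (Q *m Q^T); set iC := invmx (C^T *m C).
have MN : C *m Q *m (Q^T *m iQ *m iC *m C^T) = C *m iC *m C^T.
  by rewrite !mulmxA -[C *m Q *m Q^T]mulmxA mulmxK.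
have NM : Q^T *m iQ *m iC *m C^T *m (C *m Q) = Q^T *m iQ *m Q.
  by rewrite !mulmxA -[_ *m C^T *m C]mulmxA mulmxKV.
split; rewrite ?MN ?NM.
- by rewrite !mulmxA -[_ *m C^T *m C]mulmxA mulmxKV.
- by rewrite !mulmxA -[_ *m Q *m Q^T]mulmxA mulmxKV.
- by rewrite !trmx_mul trmxK symC mulmxA.
- by rewrite !trmx_mul trmxK symQ mulmxA.
Qed.

Lemma penrose_exists m n (M : 'M[R]_(m, n)) : exists Mp, penrose M Mp.
Proof.
rewrite -{1}(mulmx_base M); eexists; apply: penrose_full_rank.
  by rewrite -row_leq_rank mxrank_tr col_leq_rank; exact: col_base_full.
exact: row_base_free.
Qed.

(** [M *m N1] and [M *m N2] are both the orthogonal projection onto the range of [M], hence equal,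
    and symmetrically on the other side; N = N M N then determines N. *)
Lemma penrose_unique m n (M : 'M[R]_(m, n)) N1 N2 :
  penrose M N1 -> penrose M N2 -> N1 = N2.
Proof.
move=> [a1 b1 c1 d1] [a2 b2 c2 d2].
have eql : M *m N1 = M *m N2.
  rewrite -{1}a2 -mulmxA -c1 -c2 -trmx_mul; congr trmx.
  by rewrite -{3}a1 !mulmxA.
have eqr : N1 *m M = N2 *m M.
  have -> : N1 *m M = (N1 *m M) *m (N2 *m M) by rewrite -mulmxA [M *m _]mulmxA a2.
  by rewrite -{1}d1 -{1}d2 -trmx_mul -mulmxA [M *m _]mulmxA a1 d2.
by rewrite -b1 eqr -mulmxA eql mulmxA b2.
Qed.

Lemma mpinvP m n (M : 'M[R]_(m, n)) : penrose M (mpinv M).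
Proof. exact: epsilon_spec (penrose_exists M). Qed.

Lemma mpinv_eq m n (M : 'M[R]_(m, n)) N : penrose M N -> mpinv M = N.
Proof. exact: penrose_unique (mpinvP M). Qed.

Lemma trmx_mpinv n (M : 'M[R]_n) : M^T = M -> (mpinv M)^T = mpinv M.
Proof.
move=> symM; apply/esym/mpinv_eq; have [a b c d] := mpinvP M.
set N := mpinv M in a b c d *.
have MN : M *m N^T = N *m M by rewrite -d trmx_mul symM.
have NM : N^T *m M = M *m N by rewrite -c trmx_mul symM.
split.
- by rewrite -[RHS]symM -[in RHS]a !trmx_mul symM mulmxA.
- by rewrite -[in RHS]b !trmx_mul symM mulmxA.
- by rewrite MN d.
- by rewrite NM c.
Qed.

End Pseudoinverse.

(** * Square roots and perturbation of the pseudoinverse *)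

Section PsdSqrt.
Variable R : realType.

(** Makes a root of a matrix a polynomial in that matrix, so that it inherits symmetry and real
    entries although the diagonalisation is complex. *)
Lemma poly_interpolation (g : R -> R) (s : seq R) :
  exists p : {poly R}, {in s, forall x, p.[x] = g x}.
Proof.
elim: s => [|a s [p ps]]; first by exists 0.
have [as_|aNs] := boolP (a \in s).
  by exists p => x; rewrite inE => /predU1P[->|]; [exact: ps|exact: ps].
pose w := \prod_(b <- s) ('X - b%:P).
have wa : w.[a] != 0 by rewrite -rootE root_prod_XsubC.
exists (p + (g a - p.[a]) / w.[a] *: w) => x; rewrite inE => /predU1P[->|xs].
  by rewrite !hornerE divfK// addrC subrK.
have /rootP w0 : root w x by rewrite root_prod_XsubC.
by rewrite !hornerE w0 mulr0 addr0 ps.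
Qed.

Lemma trmx_horner_mx n (A : 'M[R]_n.+1) (p : {poly R}) :
  (horner_mx A p)^T = horner_mx A^T p.
Proof.
elim/poly_ind: p => [|p c IHp]; first by rewrite !raddf0.
rewrite !rmorphD/= !rmorphM/= !horner_mx_X !horner_mx_C linearD/= tr_scalar_mx.
by rewrite trmx_mul IHp; congr (_ + _); apply: comm_mx_horner.
Qed.

Local Notation C := R[i].
Local Notation cmx := (map_mx (real_complex R)).

(* The real and imaginary parts of a complex eigenvector are real eigenvectors. *)
Lemma psd_eigenvalue_ge0 n (A : 'M[R]_n) (u : 'rV[C]_n) (r : R) :
  psd A -> u != 0 -> u *m cmx A = real_complex R r *: u -> 0 <= r.
Proof.
move=> [_ psdA] u0 uA.
have real_part (h : {additive C -> R}) :
    (forall a z, h (z * real_complex R a) = h z * a) ->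
    map_mx h u != 0 -> 0 <= r.
  move=> hM hu0; set v := map_mx h u in hu0.
  have vA : v *m A = r *: v.
    apply/rowP => j; have /rowP/(_ j)/(congr1 h) := uA.
    rewrite !mxE raddf_sum mulrC hM mulrC => <-.
    by apply: eq_bigr => k _; rewrite !mxE hM.
  have := psdA v^T; rewrite trmxK vA -scalemxAl mxE.
  suff vv : 0 < (v *m v^T) 0 0 by rewrite pmulr_lge0.
  rewrite lt0r; apply/andP; split.
    apply: contra hu0 => /eqP v0; apply/eqP/mulmx_tr_eq0/matrixP => i j.
    by rewrite !ord1 v0 mxE.
  by rewrite mxE sumr_ge0// => k _; rewrite [v^T _ _]mxE -expr2 sqr_ge0.
have [Re0|] := boolP (map_mx (@complex.Re R) u != 0).
  apply: (real_part (@complex.Re R : {additive C -> R})) => //.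
  by move=> a [x y] /=; rewrite mulr0 subr0.
rewrite negbK => /eqP Re0.
apply: (real_part (@complex.Im R : {additive C -> R})) => //.
  by move=> a [x y] /=; rewrite mulr0 add0r.
apply: contra u0 => /eqP Im0; apply/eqP/rowP => k.
have /rowP/(_ k) := Re0; have /rowP/(_ k) := Im0; rewrite !mxE.
by case: (u 0 k) => x y /= -> ->.
Qed.

(** A fourth root is sought because the square of a symmetric [H] is positive semidefinite for free,
    being H^T H; the square root is then [H *m H]. *)
Lemma psd_quartic_root n (A : 'M[R]_n) : psd A ->
  exists H : 'M[R]_n, H^T = H /\ H *m H *m (H *m H) = A.
Proof.
case: n A => [|n] A psdA.
  by exists 0; rewrite trmx0; split => //; apply/matrixP => -[].
have [symA _] := psdA.
have hA : cmx A \is hermsymmx.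
  apply: realsym_hermsym.
    by apply/is_hermitianmxP; rewrite expr0 scale1r map_mx_id// map_trmx symA.
  by apply/mxOverP => i j; rewrite mxE; apply/complex_realP; eexists.
have /orthomx_spectralP := hermitian_normalmx hA.
have := hermitian_spectral_diag_real hA.
have := spectral_unit (cmx A).
set V := spectralmx _; set sp := spectral_diag _ => uV realsp AE.
pose r i := complex.Re (sp 0 i).
have spE i : sp 0 i = real_complex R (r i).
  by rewrite /r RRe_real//; move/mxOverP: realsp; apply.
have r0 i : 0 <= r i.
  apply: (@psd_eigenvalue_ge0 _ A (row i V)) => //.
    apply: contraTneq uV => Vi0; rewrite -row_free_unit; apply/negP => freeV.
    have /eqP : (delta_mx 0 i : 'rV[C]_n.+1) *m V = 0 by rewrite -rowE.
    rewrite mulmx_free_eq0// => /eqP/rowP/(_ i); rewrite !mxE !eqxx => /eqP.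
    by rewrite oner_eq0.
  rewrite AE -row_mul !mulmxA mulmxV// mul1mx -spE.
  by rewrite mul_diag_mx; apply/rowP => k; rewrite !mxE.
(* Only the values of [q] on the finitely many eigenvalues matter; the identity is checked after
   diagonalising over the complex numbers and pulled back by injectivity. *)
have [q qP] := poly_interpolation (fun x => Num.sqrt (Num.sqrt x)) (codom r).
exists (horner_mx A q); split; first by rewrite trmx_horner_mx symA.
apply: (@map_mx_inj _ _ (real_complex R)).
have -> : horner_mx A q *m horner_mx A q *m (horner_mx A q *m horner_mx A q) =
    horner_mx A (q * q * (q * q)) by rewrite !rmorphM.
rewrite map_horner_mx [in LHS]AE horner_mx_uconjC//.
suff spq : map_mx (horner (map_poly (real_complex R) (q * q * (q * q)))) sp = sp.
  by rewrite horner_mx_diag spq -AE.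
apply/rowP => i; rewrite mxE spE horner_map; congr (real_complex R _).
by rewrite !hornerM qP ?codom_f// -!expr2 sqr_sqrtr ?sqrtr_ge0// sqr_sqrtr.
Qed.

Lemma psd_sqrt_exists n (A : 'M[R]_n) : psd A ->
  exists S : 'M[R]_n, psd S /\ S *m S = A.
Proof.
move=> /psd_quartic_root[H [symH HA]]; exists (H *m H); split => //.
split; first by rewrite trmx_mul symH.
move=> v; rewrite mulmxA -mulmxA -{1}symH -trmx_mul mxE.
by apply: sumr_ge0 => k _; rewrite mxE -expr2 sqr_ge0.
Qed.

Lemma psd_sqrtP n (A : 'M[R]_n) : psd A ->
  psd (psd_sqrt A) /\ psd_sqrt A *m psd_sqrt A = A.
Proof. by move=> psdA; exact: epsilon_spec (psd_sqrt_exists psdA). Qed.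

Lemma mpinv_sym_comm n (A : 'M[R]_n) : A^T = A ->
  mpinv A *m A = A *m mpinv A.
Proof.
by move=> symA; have [_ _ <- _] := mpinvP A; rewrite trmx_mul symA trmx_mpinv.
Qed.

(** Since N = N A N with N symmetric, the quadratic form of N at v is that of A at N v. *)
Lemma psd_mpinv n (A : 'M[R]_n) : psd A -> psd (mpinv A).
Proof.
move=> [symA psdA]; split; first exact: trmx_mpinv.
move=> v; have [_ <- _ _] := mpinvP A.
have := psdA (mpinv A *m v).
by rewrite trmx_mul trmx_mpinv// !mulmxA.
Qed.

End PsdSqrt.

(** * Perturbation of the pseudoinverse on the range of Sigma *)

Section Perturbation.
Variables (R : realType) (n : nat) (Sigma Shat : 'M[R]_n).
Hypothesis psdSigma : psd Sigma.
Let Sd := mpinv Sigma.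
Let S := psd_sqrt Sd.
Let Pi := Sigma *m Sd.
Let E := Shat - Sigma.

(** [Pi] is the orthogonal projection onto the range of [Sigma]; [S] acts only there and whitens
    [Sigma], turning it into the identity of that range. *)
Lemma psd_sqrt_mpinv_range : [/\ S^T = S, S *m S = Sd,
  S *m Pi = S, Pi *m S = S & S *m Sigma *m S = Pi].
Proof.
have [symSigma _] := psdSigma; have [a b c d] := mpinvP Sigma.
have [[symS _] SS] := psd_sqrtP (psd_mpinv psdSigma).
rewrite -/Sd -/S in symS SS.
have symSd : Sd^T = Sd by exact: trmx_mpinv.
have SdSigma : Sd *m Sigma = Pi := mpinv_sym_comm symSigma.
have symPi : Pi^T = Pi := c.
have SdPi : Sd *m Pi = Sd by rewrite mulmxA.
have PiPi : Pi *m Pi = Pi by rewrite /Pi mulmxA a.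
(* Put Y = S (1 - Pi); then Y^T Y = (1 - Pi) Sd (1 - Pi) = 0 because Sd Pi = Sd. *)
have SPi : S *m Pi = S.
  apply/eqP; rewrite eq_sym -subr_eq0; apply/eqP.
  rewrite -[X in X - _]mulmx1 -mulmxBr -[S *m _]trmxK; apply/eqP.
  rewrite trmx_eq0; apply/eqP/mulmx_tr_eq0.
  rewrite trmxK trmx_mul symS linearB/= trmx1 symPi !mulmxA -[_ *m S *m S]mulmxA SS.
  by rewrite -mulmxA mulmxBr mulmx1 SdPi subrr mulmx0.
have PiS : Pi *m S = S by rewrite -symPi -symS -trmx_mul SPi.
have QS : S *m Sigma *m S *m S = S.
  by rewrite -mulmxA SS -mulmxA -/Pi.
have QPi : S *m Sigma *m S *m Pi = Pi.
  have -> : Pi = S *m (S *m Sigma) by rewrite mulmxA SS.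
  by rewrite mulmxA QS.
have symQ : (S *m Sigma *m S)^T = S *m Sigma *m S.
  by rewrite !trmx_mul symS symSigma mulmxA.
split=> //.
by have := congr1 trmx QPi; rewrite [in LHS]trmx_mul symPi symQ !mulmxA PiS.
Qed.

Hypothesis ShatPi : Pi *m Shat *m Pi = Shat.
Hypothesis small : frob (S *m E *m S) <= 2^-1.
Let K := 1%:M + S *m E *m S.

(** On the range of [Sigma], [Shat] factors as Sigma S K S Sigma. As [K] commutes with [Pi], the
    products of [Shat] with the candidate on either side are both [Pi], a symmetric projection, and
    the Penrose identities follow. *)
Lemma mpinv_perturbed : mpinv Shat = S *m invmx K *m S.
Proof.
have [symS SS SPi PiS QPi] := psd_sqrt_mpinv_range.
have SdSigma : Sd *m Sigma = Pi := mpinv_sym_comm psdSigma.1.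
(* An empty matrix is supplied because only the invertibility half is wanted here. *)
have [uK _] := frob_invmx1D (0 : 'M[R]_(n, 0)) small.
have [a b symPi d] := mpinvP Sigma.
rewrite -/Sd -/Pi in a b symPi d.
have PiPi : Pi *m Pi = Pi by rewrite {2}/Pi mulmxA a.
have SigmaPi : Sigma *m Pi = Sigma by rewrite -SdSigma mulmxA a.
have PiE : Pi *m E *m Pi = E.
  by rewrite mulmxBr mulmxBl ShatPi a SigmaPi.
have EK : Sigma + E = Shat by rewrite addrC subrK.
clearbody E.
have KPi : K *m Pi = Pi *m K.
  by rewrite /K mulmxDl mulmxDr mul1mx mulmx1 -mulmxA SPi !mulmxA PiS.
have iKPi : invmx K *m Pi = Pi *m invmx K.
  by apply: (can_inj (mulKmx uK)); rewrite mulKVmx// mulmxA KPi mulmxK.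
have ShatE : Shat = Sigma *m S *m K *m (S *m Sigma).
  rewrite /K mulmxDr mulmx1 mulmxDl !mulmxA.
  rewrite -[Sigma *m S *m S]mulmxA SS -/Pi.
  rewrite a -[_ *m S *m S]mulmxA SS.
  by rewrite -mulmxA SdSigma PiE EK.
have ShatM : Shat *m (S *m invmx K *m S) = Pi.
  rewrite ShatE !mulmxA -[_ *m S *m Sigma *m S]mulmxA -[_ *m S *m _]mulmxA.
  rewrite [S *m (Sigma *m S)]mulmxA QPi -[_ *m K *m Pi]mulmxA KPi.
  rewrite -[_ *m (Pi *m K) *m _]mulmxA -[Pi *m K *m _]mulmxA mulmxV// mulmx1.
  by rewrite -[Sigma *m S *m Pi]mulmxA SPi -mulmxA SS.
have MShat : S *m invmx K *m S *m Shat = Pi.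
  rewrite ShatE !mulmxA -[_ *m S *m Sigma *m S]mulmxA -[_ *m S *m (_ *m _)]mulmxA.
  rewrite [S *m (Sigma *m S)]mulmxA QPi -[_ *m invmx K *m Pi]mulmxA iKPi.
  by rewrite mulmxA SPi -[_ *m invmx K *m K]mulmxA mulVmx// mulmx1 SS.
apply: mpinv_eq; split; rewrite ?ShatM ?MShat//.
- by rewrite -[in LHS]ShatPi [LHS]mulmxA [X in X *m _]mulmxA PiPi.
- by rewrite !mulmxA PiS.
Qed.

Lemma frob_mpinvB d1 d2 (A : 'M[R]_(d1, n)) (B : 'M[R]_(d2, n)) :
  frob (A *m (mpinv Shat - Sd) *m B^T) <=
    frob (A *m Sd *m E *m (B *m Sd)^T) +
    2 * frob (A *m Sd *m E *m S^T) * frob (S *m E *m (B *m Sd)^T).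
Proof.
have [symS SS _ _ _] := psd_sqrt_mpinv_range.
have symSd : Sd^T = Sd by rewrite -SS trmx_mul symS.
have mpE := mpinv_perturbed.
set Y := S *m E *m (B *m Sd)^T.
have [uK KY] := frob_invmx1D Y small; rewrite -/K in uK KY.
clearbody E.
have -> : A *m (mpinv Shat - Sd) *m B^T =
    - (A *m Sd *m E *m (B *m Sd)^T) +
    (A *m Sd *m E *m S^T) *m (invmx K *m Y).
  (* With G = S E S, the exact second-order resolvent identity K^-1 = 1 - G + G K^-1 G. It needs no
     power series and leaves the inverse between two deviations. *)
  have iKE : invmx K = 1%:M - S *m E *m S + S *m E *m S *m invmx K *m (S *m E *m S).
    set G := S *m E *m S in uK *.
    have iKG : invmx K *m G = 1%:M - invmx K.
      have h : invmx K + invmx K *m G = 1%:M.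
        by rewrite -[X in X + _]mulmx1 -mulmxDr; exact: mulVmx.
      by rewrite -h [X in _ = X - _]addrC addrK.
    have GiK : G *m invmx K = 1%:M - invmx K.
      have h : invmx K + G *m invmx K = 1%:M.
        by rewrite -[X in X + _]mul1mx -mulmxDl; exact: mulmxV.
      by rewrite -h [X in _ = X - _]addrC addrK.
    rewrite -mulmxA iKG mulmxBr mulmx1 GiK.
    by rewrite subrKA opprB addrC subrK.
  have -> : mpinv Shat - Sd =
      - (Sd *m E *m Sd) + Sd *m E *m S *m invmx K *m S *m E *m Sd.
    rewrite mpE {1}iKE !(mulmxDr, mulmxDl, mulmxN, mulNmx) !mulmx1 !mulmxA SS.
    rewrite -[_ *m S *m S in X in - X]mulmxA -[_ *m E *m S *m S]mulmxA SS.
    by rewrite [LHS]addrC !addrA addNr add0r.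
  rewrite /Y trmx_mul symSd symS !(mulmxDr, mulmxDl, mulmxN, mulNmx).
  by rewrite !mulmxA.
apply: le_trans (frobD _ _) _; rewrite frobN lerD2l.
apply: le_trans (frobM _ _) _.
rewrite [2 * _]mulrC -mulrA.
by apply: ler_wpM2l; rewrite ?frob_ge0.
Qed.

End Perturbation.

(** * Expectation and independence *)

Section BoundedMeasurable.
Context d (T : measurableType d) (R : realType).
Implicit Types f g : T -> R.

(** A class stable under sums, products and the exponential, and integrable under every probability,
    so that integrability side conditions reduce to closure properties. *)
Definition bounded_measurable f :=
  measurable_fun setT f /\ exists M, forall x, `|f x| <= M.

Lemma bounded_measurable_cst (r : R) : bounded_measurable (fun=> r).
Proof. by split; [exact: measurable_cst|exists `|r|]. Qed.

Lemma bounded_measurableD f g : bounded_measurable f -> bounded_measurable g ->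
  bounded_measurable (fun x => f x + g x).
Proof.
move=> [mf [M fM]] [mg [M' gM']]; split; first exact: measurable_funD.
by exists (M + M') => x; apply: le_trans (ler_normD _ _) (lerD _ _).
Qed.

Lemma bounded_measurableM f g : bounded_measurable f -> bounded_measurable g ->
  bounded_measurable (fun x => f x * g x).
Proof.
move=> [mf [M fM]] [mg [M' gM']]; split; first exact: measurable_funM.
by exists (M * M') => x; rewrite normrM ler_pM.
Qed.

Lemma bounded_measurable_sum (I : Type) (s : seq I) (f : I -> T -> R) :
  (forall i, bounded_measurable (f i)) ->
  bounded_measurable (fun x => \sum_(i <- s) f i x).
Proof.
move=> bf; elim: s => [|i s IHs].
  by under eq_fun do rewrite big_nil; exact: bounded_measurable_cst.
by under eq_fun do rewrite big_cons; exact: bounded_measurableD.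
Qed.

Lemma bounded_measurableX f n : bounded_measurable f ->
  bounded_measurable (fun x => f x ^+ n).
Proof.
move=> bf; elim: n => [|n IHn].
  by under eq_fun do rewrite expr0; exact: bounded_measurable_cst.
by under eq_fun do rewrite exprS; exact: bounded_measurableM.
Qed.

Lemma bounded_measurable_expR f : bounded_measurable f ->
  bounded_measurable (fun x => expR (f x)).
Proof.
move=> [mf [M fM]]; split; first exact: measurableT_comp.
exists (expR M) => x; rewrite ger0_norm ?expR_ge0// ler_expR.
exact: le_trans (ler_norm _) (fM x).
Qed.

Lemma bounded_measurable_integrable (P : probability T R) f :
  bounded_measurable f -> P.-integrable setT (EFin \o f).
Proof.
move=> [mf [M fM]]; apply: measurable_bounded_integrable => //.
  exact: le_lt_trans (probability_le1 P measurableT) (ltry 1).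
exists M; split; rewrite ?num_real// => r Mr x _ /=.
exact: le_trans (fM x) (ltW Mr).
Qed.

End BoundedMeasurable.

Section Expectation.
Context d (T : measurableType d) (R : realType) (P : probability T R).
Implicit Types f g : T -> R.
Local Notation integ f := (P.-integrable setT (fun x => (f x)%:E)).

Lemma expect_cst (r : R) : expect P (fun=> r) = r.
Proof. by rewrite [LHS]Rintegral_cst//= probability_setT mulr1. Qed.

Lemma expectD f g : integ f -> integ g ->
  expect P (fun x => f x + g x) = expect P f + expect P g.
Proof. exact: RintegralD. Qed.

Lemma expectZ (r : R) f : integ f ->
  expect P (fun x => r * f x) = r * expect P f.
Proof. exact: RintegralZl. Qed.

Lemma integ_sum (I : Type) (s : seq I) (f : I -> T -> R) :
  (forall i, integ (f i)) -> integ (fun x => \sum_(i <- s) f i x).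
Proof.
move=> intf; under eq_fun do rewrite -sumEFin.
exact: integrable_sum.
Qed.

Lemma expect_sum (I : Type) (s : seq I) (f : I -> T -> R) :
  (forall i, integ (f i)) ->
  expect P (fun x => \sum_(i <- s) f i x) = \sum_(i <- s) expect P (f i).
Proof.
move=> intf; elim: s => [|i s IHs].
  rewrite big_nil -[RHS](expect_cst 0); congr (expect P _); apply/funext => x.
  by rewrite big_nil.
rewrite big_cons -IHs -expectD//; last exact: integ_sum.
by congr (expect P _); apply/funext => x; rewrite big_cons.
Qed.

Lemma integZ (r : R) f : integ f -> integ (fun x => r * f x).
Proof.
by move=> intf; under eq_fun do rewrite EFinM; exact: integrableZl.
Qed.

Lemma integD f g : integ f -> integ g -> integ (fun x => f x + g x).
Proof. by move=> intf intg; exact: (integrableD measurableT intf intg). Qed.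

Lemma expect_le f g : integ f -> integ g -> (forall x, f x <= g x) ->
  expect P f <= expect P g.
Proof. by move=> intf intg fg; apply: le_Rintegral. Qed.

Lemma expect_ae f g : measurable_fun setT f -> measurable_fun setT g ->
  {ae P, forall x, f x = g x} -> expect P f = expect P g.
Proof.
move=> mf mg fg; congr fine; apply: ae_eq_integral => //.
- exact/measurable_EFinP.
- exact/measurable_EFinP.
- by apply: filterS fg => x fgx _; rewrite /= fgx.
Qed.

(** Markov's inequality at threshold 1, by domination of the indicator of [A]. *)
Lemma probability_le_expect (A : set T) g : measurable A -> integ g ->
  (forall x, 0 <= g x) -> (forall x, A x -> 1 <= g x) ->
  (P A <= (expect P g)%:E)%E.
Proof.
move=> mA intg g0 g1.
rewrite /expect fineK; last exact: integrable_fin_num.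
rewrite -[A]setIT -integral_indic//.
apply: ge0_le_integral => //.
- exact/measurable_EFinP/measurable_indic.
- by have /integrableP[] := intg.
- move=> x _; rewrite lee_fin indicE; case: (boolP (x \in A)) => [|_]; last exact: g0.
  by rewrite inE => /g1.
Qed.

Lemma probability_setC_ge (A : set T) (r : R) : measurable A ->
  (P (~` A) <= r%:E -> (1 - r)%:E <= P A)%E.
Proof.
move=> mA; rewrite probability_setC//.
have : P A \is a fin_num by exact: fin_num_measure.
by case: (P A) => //= p _; rewrite -EFinB !lee_fin; lra.
Qed.

Section Independence.
Context d1 d2 (T1 : measurableType d1) (T2 : measurableType d2).
Variables (X1 : {mfun T >-> T1}) (X2 : {mfun T >-> T2}).
Hypothesis indep : forall A B, measurable A -> measurable B ->
  P (X1 @^-1` A `&` X2 @^-1` B) = (P (X1 @^-1` A) * P (X2 @^-1` B))%E.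

(** The joint law of the pair agrees with the product law on rectangles, hence everywhere, and
    Fubini splits the integral. *)
Lemma expect_indepM (f : T1 -> R) (h : T2 -> R) :
  bounded_measurable f -> bounded_measurable h ->
  expect P (fun x => f (X1 x) * h (X2 x)) =
  expect P (f \o X1) * expect P (h \o X2).
Proof.
move=> bf bh.
have mX : measurable_fun setT (fun x => (X1 x, X2 x)).
  exact: measurable_fun_pair.
pose X : {mfun T >-> (T1 * T2)%type} := mfun_Sub (mem_set mX).
have XE x : X x = (X1 x, X2 x) by [].
pose g (z : T1 * T2) := f z.1 * h z.2.
have bg : bounded_measurable g.
  have [mf [M fM]] := bf; have [mh [M' hM']] := bh.
  apply: bounded_measurableM.
    by split; [exact: measurableT_comp|exists M => z; exact: fM].
  by split; [exact: measurableT_comp|exists M' => z; exact: hM'].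
have mgE : measurable_fun setT (fun z : T1 * T2 => (g z)%:E).
  by apply/measurable_EFinP; exact: bg.1.
pose D1 := distribution P X1; pose D2 := distribution P X2.
have bcomp d' (T' : measurableType d') (Y : {mfun T >-> T'}) (k : T' -> R) :
    bounded_measurable k -> bounded_measurable (k \o Y).
  by move=> [mk [M kM]]; split; [exact: measurableT_comp|exists M => x; exact: kM].
have eX : expect P (fun x => f (X1 x) * h (X2 x)) =
    fine (\int[distribution P X]_z (EFin \o g) z).
  rewrite integral_distribution//.
  by apply: (bounded_measurable_integrable P (f := g \o X)); exact: bcomp.
have eI : (\int[distribution P X]_z (EFin \o g) z =
    \int[(D1 \x D2)%E]_z (EFin \o g) z)%E.
  apply: eq_measure_integral => A mA _; apply/esym.
  apply: (product_measure_unique (m' := distribution P X)) => //.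
have intg : ((D1 \x D2)%E).-integrable setT (EFin \o g).
  exact: bounded_measurable_integrable.
have eh : (\int[D2]_y (EFin \o h) y = (expect P (h \o X2))%:E)%E.
  rewrite integral_distribution//.
  - by rewrite fineK//; apply: integrable_fin_num => //;
      apply: (bounded_measurable_integrable P (f := h \o X2)); exact: bcomp.
  - by apply/measurable_EFinP; exact: bh.1.
  - by apply: (bounded_measurable_integrable P (f := h \o X2)); exact: bcomp.
rewrite eX eI -integral12_prod_meas1//.
have -> : (\int[D1]_x \int[D2]_y (EFin \o g) (x, y) =
    \int[D1]_x ((f x)%:E * (expect P (h \o X2))%:E))%E.
  apply: eq_integral => x _; rewrite -eh -integralZl//; last first.
    exact: bounded_measurable_integrable.
rewrite integralZr//; last exact: bounded_measurable_integrable.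
rewrite -[X in (X * _)%E]/(\int[D1]_x (EFin \o f) x)%E integral_distribution//.
- rewrite fineM//; apply: integrable_fin_num => //.
  by apply: (bounded_measurable_integrable P (f := f \o X1)); exact: bcomp.
- by apply/measurable_EFinP; exact: bf.1.
- by apply: (bounded_measurable_integrable P (f := f \o X1)); exact: bcomp.
Qed.

End Independence.

(* Dynkin's pi-lambda theorem, applied to one of the two families at a time. *)
Lemma indep_sigma (G H : set (set T)) :
    setI_closed G -> setI_closed H -> G setT -> H setT ->
    G `<=` measurable -> H `<=` measurable ->
    (forall A B, G A -> H B -> P (A `&` B) = (P A * P B)%E) ->
  forall A B, <<s G >> A -> <<s H >> B -> P (A `&` B) = (P A * P B)%E.
Proof.
have ext (K : set (set T)) (B : set T) : setI_closed K -> K setT ->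
    K `<=` measurable -> measurable B ->
    (forall A, K A -> P (A `&` B) = (P A * P B)%E) ->
    forall A, <<s K >> A -> P (A `&` B) = (P A * P B)%E.
  move=> KI KT Km mB KB A sKA.
  have PBfin : P B \is a fin_num by exact: fin_num_measure.
  have pB0 : 0 <= fine (P B) by exact: fine_ge0.
  rewrite muleC -(fineK PBfin).
  (* As functions of [A] the two sides are finite measures: [P] restricted to [B], and [P] scaled by
     the mass of [B]. They agree on the generating pi-system. *)
  rewrite -[LHS]/(mrestr P mB A).
  rewrite -[RHS]/(mscale (NngNum pB0) P A).
  apply: (g_sigma_algebra_measure_unique K Km (fun=> setT)) => //.
  - by rewrite bigcup_const//; exists 0%N.
  - move=> E KE; rewrite /= /mrestr /mscale /= fineK// muleC; exact: KB.
  - move=> _; rewrite /= /mrestr setTI.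
    by rewrite -ge0_fin_numE.
move=> GI HI GT HT Gm Hm GH A B sGA sHB.
have sm (K : set (set T)) : K `<=` measurable -> <<s K >> `<=` @measurable _ T.
  by move=> Km; apply: smallest_sub => //; exact: sigma_algebra_measurable.
apply: (@ext G) => //; first exact: sm sHB.
move=> A' GA'; rewrite setIC muleC.
apply: (@ext H) => //; first exact: Gm.
by move=> B' HB'; rewrite setIC muleC; exact: GH.
Qed.

End Expectation.

(** * Hoeffding inequality for vector martingale differences *)

(** From e^(-x) >= 1 - x one gets e^x (1 - x) <= 1, hence e^x <= 1 + x + x^2 for x <= 0 and e^x <= 1
    + x + 2 x^2 for 0 < x <= 1/2, both below the claim as e^(2x^2) >= 1 + 2x^2. For x > 1/2 already
    x <= 2x^2. *)
Lemma expR_le_addr_sqr (R : realType) (x : R) : expR x <= x + expR (2 * x ^+ 2).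
Proof.
have e2 := expR_ge1Dx (2 * x ^+ 2).
have eN : expR x * (1 - x) <= 1.
  have := expR_ge1Dx (- x); rewrite expRN => h.
  by rewrite mulrC -ler_pdivlMr ?expR_gt0// div1r.
have e0 := expR_ge0 x.
have [x0|x0] := lerP x 0.
  have : expR x * (1 - x) <= (1 + x + x ^+ 2) * (1 - x) by nra.
  by rewrite ler_pM2r; nra.
have [x2|x2] := lerP x 2^-1.
  have : expR x * (1 - x) <= (1 + x + 2 * x ^+ 2) * (1 - x) by nra.
  by rewrite ler_pM2r; lra.
have : expR x <= expR (2 * x ^+ 2) by rewrite ler_expR; nra.
lra.
Qed.

Section VectorHoeffding.
Context d (T : measurableType d) (R : realType) (P : probability T R).
Variables (J : finType) (N : nat) (W : nat -> J -> T -> R).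
Variable F : nat -> set (set T).
Hypothesis N_gt0 : (0 < N)%N.
Hypothesis W_meas : forall k j, measurable_fun setT (W k j).
Hypothesis W_le1 : forall k x, \sum_j W k j x ^+ 2 <= 1.
Hypothesis W_adapted : forall i k j, (i < k)%N ->
  measurable_fun (setT : set (g_sigma_algebraType (F k))) (W i j).
(** The martingale difference property without conditional expectations: increment [k] is orthogonal
    to every bounded function measurable for the past. *)
Hypothesis W_centered : forall k j (h : g_sigma_algebraType (F k) -> R),
  (k < N)%N -> bounded_measurable h ->
  expect P (fun x => W k j x * h x) = 0.

Let S k j x := \sum_(i < k) W i j x.

Let W_bound k j x : `|W k j x| <= 1.
Proof.
rewrite -(@ler_pXn2r _ 2%N)// ?nnegrE// real_normK ?num_real// expr1n.
apply: le_trans (W_le1 k x); rewrite (bigD1 j)//= lerDl.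
by apply: sumr_ge0 => i _; exact: sqr_ge0.
Qed.

Let bmW k j : bounded_measurable (W k j).
Proof. by split=> //; exists 1. Qed.

Let bmS k j : bounded_measurable (S k j).
Proof. exact: bounded_measurable_sum. Qed.

(** The partial sum is read on the coarser sigma-algebra of the past, as is needed to use it in a
    test function for [W_centered]. *)
Let bmS_past k j : bounded_measurable (S k j : g_sigma_algebraType (F k) -> R).
Proof. by apply: bounded_measurable_sum => i; split; [exact: W_adapted|exists 1]. Qed.

Let expS s k x := expR (s * \sum_j S k j x ^+ 2).

Let bm_expS s k : bounded_measurable (expS s k).
Proof.
apply/bounded_measurable_expR/bounded_measurableM; first exact: bounded_measurable_cst.
by apply: bounded_measurable_sum => j; exact: bounded_measurableX.
Qed.

Let bm_expS_past s k : bounded_measurable (expS s k : g_sigma_algebraType (F k) -> R).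
Proof.
apply/bounded_measurable_expR/bounded_measurableM; first exact: bounded_measurable_cst.
by apply: bounded_measurable_sum => j; exact: bounded_measurableX.
Qed.

(** With a = |S_k|^2 and c = <W_k, S_k>, one has |S_k + W_k|^2 <= a + 2c + 1, e^(2sc) <= 2sc + e^(8
    s^2 c^2), and c^2 <= a. The linear term is kept as a sum of [W k j] times a function of the
    past, the shape that [W_centered] annihilates. *)
Let expS_step s k x : 0 <= s ->
  expS s k.+1 x <= expR s *
    (\sum_j 2 * s * (W k j x * (expS s k x * S k j x)) +
     expS (s + 8 * s ^+ 2) k x).
Proof.
move=> s0; set a := \sum_j S k j x ^+ 2; set c := \sum_j W k j x * S k j x.
have a0 : 0 <= a by apply: sumr_ge0 => j _; exact: sqr_ge0.
have ca : c ^+ 2 <= a.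
  apply: le_trans (cauchy_schwarz _ _) _.
  by rewrite -[leRHS]mul1r; apply: ler_wpM2r.
have -> : \sum_j 2 * s * (W k j x * (expS s k x * S k j x)) =
    expR (s * a) * (2 * s * c).
  rewrite /expS -/a /c !mulr_sumr; apply: eq_bigr => j _; ring.
have -> : expS s k.+1 x = expR (s * (a + 2 * c + \sum_j W k j x ^+ 2)).
  rewrite /expS; congr (expR (_ * _)).
  rewrite /a /c mulr_sumr -!big_split/=; apply: eq_bigr => j _.
  by rewrite /S big_ord_recr/=; ring.
rewrite /expS -/a.
apply: (@le_trans _ _ (expR (s + (s * a + 2 * s * c)))).
  by rewrite ler_expR; have := W_le1 k x; nra.
rewrite expRD; apply: ler_wpM2l; first exact: expR_ge0.
have -> : expR ((s + 8 * s ^+ 2) * a) = expR (s * a) * expR (8 * s ^+ 2 * a).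
  by rewrite -expRD; congr expR; ring.
rewrite expRD -mulrDr; apply: ler_wpM2l; first exact: expR_ge0.
apply: le_trans (expR_le_addr_sqr _) _; rewrite lerD2l ler_expR.
by rewrite exprMn exprMn; have := sqr_ge0 s; nra.
Qed.

(** The weights must satisfy s_(k+1) + 8 s_(k+1)^2 <= s_k, a discrete form of s' = -8 s^2, solved by
    1/(8(k + const)). The choice const = N keeps every weight at most 1/(8N), so each step costs at
    most a factor e^(1/(8N)). *)
Lemma expect_expR_sqnorm_sum k : (k <= N)%N ->
  expect P (fun x => expR ((8 * (N + k)%:R)^-1 *
     \sum_j (\sum_(i < k) W i j x) ^+ 2)) <= expR (k%:R / (8 * N%:R)).
Proof.
rewrite -[expect _ _]/(expect P (expS _ _)).
elim: k => [_|k IHk kN].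
  rewrite mul0r expR0 -[leRHS](expect_cst P 1) le_eqVlt; apply/orP; left; apply/eqP.
  congr expect; apply/funext => x; rewrite /expS big1 ?mulr0 ?expR0// => j _.
  by rewrite /S big_ord0 expr0n.
set s := (8 * (N + k.+1)%:R)^-1.
have Nk : 1 <= (N + k)%:R :> R by rewrite ler1n addn_gt0 N_gt0.
have s0 : 0 <= s by rewrite invr_ge0 mulr_ge0.
(* With m = N + k this reduces to m (m + 2) <= (m + 1)^2. *)
have ss : s + 8 * s ^+ 2 <= (8 * (N + k)%:R)^-1.
  have sE : (N + k.+1)%:R = (N + k)%:R + 1 :> R by rewrite addnS -natr1.
  rewrite /s sE; move: Nk; set m := (N + k)%:R => m1.
  have -> : (8 * (m + 1))^-1 + 8 * (8 * (m + 1))^-1 ^+ 2 =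
      (m + 2) / (8 * (m + 1) ^+ 2) by field; lra.
  have -> : (8 * m)^-1 = m^-1 / 8 by field; lra.
  rewrite ler_pdivrMr ?mulr_gt0 ?exprn_gt0; try lra.
  have -> : m^-1 / 8 * (8 * (m + 1) ^+ 2) = m + 2 + m^-1 by field; lra.
  by rewrite lerDl invr_ge0; lra.
have intg f : bounded_measurable f -> P.-integrable setT (fun x => (f x)%:E).
  exact: bounded_measurable_integrable.
have bmj j : bounded_measurable (fun x => W k j x * (expS s k x * S k j x)).
  by do 2 apply: bounded_measurableM => //.
have bmsum : bounded_measurable
    (fun x => \sum_j 2 * s * (W k j x * (expS s k x * S k j x))).
  apply: bounded_measurable_sum => j; apply: bounded_measurableM => //.
  exact: bounded_measurable_cst.
apply: (@le_trans _ _ (expR s * expect P (expS (s + 8 * s ^+ 2) k))).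
  have bmr : bounded_measurable (fun x =>
     \sum_j 2 * s * (W k j x * (expS s k x * S k j x)) +
     expS (s + 8 * s ^+ 2) k x) by exact: bounded_measurableD.
  apply: le_trans (expect_le _ _ (fun x => expS_step k x s0)) _.
  - exact: intg.
  - by apply: intg; apply: bounded_measurableM => //; exact: bounded_measurable_cst.
  rewrite expectZ ?expectD; try exact: intg.
  apply: ler_wpM2l; first exact: expR_ge0.
  rewrite expect_sum => [|j]; last by apply: integZ; exact: intg.
  rewrite big1 ?add0r// => j _; rewrite expectZ; last exact: intg.
  rewrite (W_centered j (h := fun x => expS s k x * S k j x)) ?mulr0//.
  exact: bounded_measurableM.
apply: (@le_trans _ _ (expR (8 * N%:R)^-1 * expR (k%:R / (8 * N%:R)))).
  apply: ler_pM; rewrite ?expR_ge0//.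
  - by apply: Rintegral_ge0 => x _; exact: expR_ge0.
  - rewrite ler_expR /s lef_pV2 ?posrE ?mulr_gt0 ?ltr0n ?addn_gt0 ?N_gt0//.
    by rewrite ler_wpM2l// ler_nat leq_addr.
  - apply: le_trans (IHk (ltnW kN)).
    apply: expect_le => [||x]; try exact: intg.
    rewrite ler_expR ler_wpM2r// sumr_ge0// => j _; exact: sqr_ge0.
have kE : k.+1%:R = k%:R + 1 :> R by rewrite -natr1.
by rewrite -expRD ler_expR kE; lra.
Qed.

(** Chernoff's bound with the last weight 1/(8(N + N)) = 1/(16N); the term 1/8 is the total cost of
    the N steps. *)
Lemma vector_hoeffding (r : R) :
  (P [set x | (r < \sum_j (\sum_(i < N) W i j x) ^+ 2)%R] <=
    (expR (8^-1 - r / (16 * N%:R)))%:E)%E.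
Proof.
set c : R := (8 * (N + N)%:R)^-1.
have N0 : (0 : R) < N%:R by rewrite ltr0n.
have cE : c = (16 * N%:R)^-1 by rewrite /c natrD; field; lra.
have c0 : 0 < c by rewrite cE invr_gt0 mulr_gt0.
have bmg : bounded_measurable (fun x => expR (- (r * c)) * expS c N x).
  by apply: bounded_measurableM => //; exact: bounded_measurable_cst.
have mS : measurable_fun setT (fun x => \sum_j (S N j x) ^+ 2).
  by apply: (bounded_measurable_sum _ _).1 => j; exact: bounded_measurableX.
have mA : measurable [set x | (r < \sum_j (\sum_(i < N) W i j x) ^+ 2)%R].
  rewrite -[X in measurable X]setTI.
  by apply: (measurable_fun_ltr (f := cst r) _ mS) => //; exact: measurable_cst.
apply: le_trans (probability_le_expect
  (g := fun x => expR (- (r * c)) * expS c N x) _ _ _ _) _ => //.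
- exact: bounded_measurable_integrable.
- by move=> x; rewrite mulr_ge0 ?expR_ge0.
- move=> x /= rx; rewrite -expRD -expR0 ler_expR addrC subr_ge0 mulrC.
  by rewrite ler_wpM2l ?ltW.
rewrite lee_fin expectZ; last exact: (bounded_measurable_integrable P (bm_expS c N)).
rewrite addrC expRD -cE; apply: ler_wpM2l; first exact: expR_ge0.
have := expect_expR_sqnorm_sum (leqnn N).
suff -> : N%:R / (8 * N%:R) = 8^-1 :> R by [].
by field; lra.
Qed.

End VectorHoeffding.

(** * Independent copies of a random vector *)

(** The sets on which [same_law] and [mutually_independent] are tested. Column vectors carry the
    sigma-algebra they generate, so uniqueness on pi-systems applies directly. *)
Definition vrect (R : realType) (D : nat) : set (set 'cV[R]_D) :=
  [set [set v : 'cV[R]_D | forall k, B k (v k 0)] |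
    B in [set B : 'I_D -> set R | forall k, measurable (B k)]].

Notation mvec R D := (g_sigma_algebraType (@vrect R D)).

Section RandomVectors.
Variables (R : realType) (D : nat).

Lemma vrect_setI : setI_closed (@vrect R D).
Proof.
move=> _ _ [B1 mB1 <-] [B2 mB2 <-]; exists (fun k => B1 k `&` B2 k).
  by move=> k; exact: measurableI.
by apply/seteqP; split=> v /=; [move=> h; split=> k; case: (h k)|move=> [h1 h2] k; split].
Qed.

Lemma vrect_setT : vrect (setT : set 'cV[R]_D).
Proof. by exists (fun=> setT) => //; apply/seteqP; split. Qed.

Lemma vrect_measurable : @vrect R D `<=` @measurable _ (mvec R D).
Proof. by move=> A; exact: sub_sigma_algebra. Qed.

Lemma measurable_coord (k : 'I_D) :
  measurable_fun setT (fun v : mvec R D => v k 0).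
Proof.
move=> _ A mA; rewrite setTI; apply: vrect_measurable.
exists (fun k' => if k' == k then A else setT) => [k'|]; first by case: ifP.
apply/seteqP; split=> v /=; first by move=> /(_ k); rewrite eqxx.
by move=> Av k'; case: eqP => // ->.
Qed.

Context d (T : measurableType d).
Implicit Types X Y : T -> mvec R D.

Lemma random_vector_measurable X : random_vector X -> measurable_fun setT X.
Proof.
move=> rvX; apply: (@measurability _ _ _ _ setT X (@vrect R D)) => //.
move=> _ [_ [B mB <-] <-]; rewrite setTI.
have -> : X @^-1` [set v | forall k, B k (v k 0)] =
    \bigcap_(k in setT) ((fun x => X x k 0) @^-1` B k).
  by apply/seteqP; split=> x /= h; [move=> k _; exact: h|move=> k; exact: h].
apply: fin_bigcap_measurable => // k _.
by rewrite -[X in measurable X]setTI; exact: rvX.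
Qed.

Variable P : probability T R.

Lemma same_law_distribution X Y : random_vector X -> random_vector Y ->
  same_law P Y X ->
  forall A : set (mvec R D), measurable A -> P (Y @^-1` A) = P (X @^-1` A).
Proof.
move=> /random_vector_measurable mX /random_vector_measurable mY YX A mA.
pose X' : {mfun T >-> mvec R D} := mfun_Sub (mem_set mX).
pose Y' : {mfun T >-> mvec R D} := mfun_Sub (mem_set mY).
apply: (g_sigma_algebra_measure_unique (T := mvec R D) (@vrect R D)
  vrect_measurable (fun=> setT)
  _ _ (distribution P Y') (distribution P X')) => //.
- by move=> _; exact: vrect_setT.
- by rewrite bigcup_const//; exists 0%N.
- exact: vrect_setI.
- by move=> _ [B mB <-]; exact: YX.
- move=> _; apply: le_lt_trans (ltry 1).
  exact: (probability_le1 (distribution P Y') measurableT).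
Qed.

Lemma same_law_expect X Y (f : mvec R D -> R) :
  random_vector X -> random_vector Y -> same_law P Y X ->
  bounded_measurable f -> expect P (f \o Y) = expect P (f \o X).
Proof.
move=> rX rY YX bf.
have mX := random_vector_measurable rX; have mY := random_vector_measurable rY.
pose X' : {mfun T >-> mvec R D} := mfun_Sub (mem_set mX).
pose Y' : {mfun T >-> mvec R D} := mfun_Sub (mem_set mY).
have bcomp (Z : {mfun T >-> mvec R D}) : P.-integrable setT (EFin \o (f \o Z)).
  have [mf [M fM]] := bf; apply: bounded_measurable_integrable.
  by split; [exact: measurableT_comp|exists M => x; exact: fM].
have mf : measurable_fun setT (EFin \o f) by apply/measurable_EFinP; exact: bf.1.
rewrite /expect -[in LHS](integral_distribution (X := Y') mf (bcomp Y')).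
rewrite -[in RHS](integral_distribution (X := X') mf (bcomp X')).
congr fine; apply: eq_measure_integral => A mA _.
exact: same_law_distribution.
Qed.

Lemma same_law_ae X Y (Q : set (mvec R D)) :
  random_vector X -> random_vector Y -> same_law P Y X -> measurable Q ->
  {ae P, forall x, Q (X x)} -> {ae P, forall x, Q (Y x)}.
Proof.
move=> rX rY YX mQ.
have mpre (Z : T -> mvec R D) : random_vector Z -> measurable (Z @^-1` (~` Q)).
  move=> rZ; rewrite -[X in measurable X]setTI.
  by apply: (random_vector_measurable rZ) => //; exact: measurableC.
move=> /(negligibleP P (mpre _ rX)) X0; apply/(negligibleP P (mpre _ rY)).
by rewrite -X0; apply: same_law_distribution => //; exact: measurableC.
Qed.

End RandomVectors.

(** * Concentration of the empirical mean of independent copies *)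

Section IidHoeffding.
Context d (T : measurableType d) (R : realType) (P : probability T R).
Variables (D N : nat) (X : T -> 'cV[R]_D) (Xs : 'I_N -> T -> 'cV[R]_D).
Hypothesis N_gt0 : (0 < N)%N.
Hypothesis rvX : random_vector X.
Hypothesis rvXs : forall i, random_vector (Xs i).
Hypothesis lawXs : forall i, same_law P (Xs i) X.
Hypothesis indepXs : mutually_independent P Xs.

(** Rectangles in the copies of index below [k]: a pi-system generating the sigma-algebra of the
    past in the martingale inequality. *)
Let past (k : nat) : set (set T) :=
  [set [set x | forall i : 'I_N, (i < k)%N -> forall j, B i j (Xs i x j 0)] |
    B in [set B : 'I_N -> 'I_D -> set R | forall i j, measurable (B i j)]].

Let present (k : 'I_N) : set (set T) := [set Xs k @^-1` A | A in @vrect R D].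

Let past_setI k : setI_closed (past k).
Proof.
move=> _ _ [B1 mB1 <-] [B2 mB2 <-]; exists (fun i j => B1 i j `&` B2 i j).
  by move=> i j; exact: measurableI.
apply/seteqP; split=> x /=.
  by move=> h; split=> i ik j; case: (h i ik j).
by move=> [h1 h2] i ik j; split; [exact: h1|exact: h2].
Qed.

Let past_setT k : past k setT.
Proof. by exists (fun _ _ => setT) => //; apply/seteqP; split. Qed.

Let measurable_coords (B : 'I_N -> 'I_D -> set R) (Q : 'I_N -> bool) :
  (forall i j, measurable (B i j)) ->
  measurable [set x | forall i, Q i -> forall j, B i j (Xs i x j 0)].
Proof.
move=> mB.
have -> : [set x | forall i, Q i -> forall j, B i j (Xs i x j 0)] =
    \bigcap_(i in [set i | Q i]) \bigcap_(j in setT) ((fun x => Xs i x j 0) @^-1` B i j).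
  by apply/seteqP; split=> x /= h; [move=> i Qi j _; exact: h|move=> i Qi j; exact: h].
apply: fin_bigcap_measurable => // i _; apply: fin_bigcap_measurable => // j _.
by rewrite -[X in measurable X]setTI; exact: rvXs.
Qed.

Let past_measurable k : past k `<=` measurable.
Proof. by move=> _ [B mB <-]; exact: (measurable_coords (fun i => i < k)%N). Qed.

Let present_setI k : setI_closed (present k).
Proof.
move=> _ _ [A1 r1 <-] [A2 r2 <-]; exists (A1 `&` A2); first exact: vrect_setI.
by rewrite preimage_setI.
Qed.

Let present_setT k : present k setT.
Proof. by exists setT; [exact: vrect_setT|rewrite preimage_setT]. Qed.

Let present_measurable k : present k `<=` measurable.
Proof.
move=> _ [A rA <-]; rewrite -[X in measurable X]setTI.
by apply: random_vector_measurable => //; exact: vrect_measurable.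
Qed.

Let past_present_indep (k : 'I_N) (A B : set T) : past k A -> present k B ->
  P (A `&` B) = (P A * P B)%E.
Proof.
move=> [C mC <-] [_ [C' mC' <-] <-].
(* The independence hypothesis speaks of all N copies at once, so rectangles are padded: [E] has
   full sides from index [k] on, and [E'] inserts the present rectangle at [k]. *)
pose E (i : 'I_N) j := if (i < k)%N then C i j else setT : set R.
pose E' (i : 'I_N) j := if i == k then C' j else E i j.
have mE i j : measurable (E i j) by rewrite /E; case: ifP.
have mE' i j : measurable (E' i j) by rewrite /E'; case: ifP.
have -> : [set x | forall i : 'I_N, (i < k)%N -> forall j, C i j (Xs i x j 0)] =
    [set x | forall i j, E i j (Xs i x j 0)].
  apply/seteqP; split=> x /= h i => [j|ik j].
    by rewrite /E; case: ifP => // ik; exact: h.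
  by have := h i j; rewrite /E ik.
have -> : [set x | forall i j, E i j (Xs i x j 0)] `&`
    Xs k @^-1` [set v | forall j, C' j (v j 0)] =
    [set x | forall i j, E' i j (Xs i x j 0)].
  apply/seteqP; split=> x /=.
    by move=> [h h'] i j; rewrite /E'; case: eqP => [->|_]; [exact: h'|exact: h].
  move=> h; split=> [i j|j].
    by have := h i j; rewrite /E'; case: eqP => // ->; rewrite /E ltnn.
  by have := h k j; rewrite /E' eqxx.
rewrite (indepXs mE) (indepXs mE') (bigD1 k)//= [in RHS](bigD1 k)//=.
have -> : [set x | forall j, E k j (Xs k x j 0)] = setT.
  by apply/seteqP; split=> x //= _ j; rewrite /E ltnn.
have -> : [set x | forall j, E' k j (Xs k x j 0)] =
    Xs k @^-1` [set v | forall j, C' j (v j 0)].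
  by apply/seteqP; split=> x /= h j; have := h j; rewrite /E' eqxx.
rewrite probability_setT mul1e muleC; congr (_ * _)%E.
apply: eq_bigr => i ik; congr (P _).
by apply/seteqP; split=> x /= h j; have := h j; rewrite /E' (negbTE ik).
Qed.

Let Xs_past (i : 'I_N) k : (i < k)%N ->
  measurable_fun (setT : set (g_sigma_algebraType (past k))) (Xs i : _ -> mvec R D).
Proof.
move=> ik.
apply: (@measurability _ _ (g_sigma_algebraType (past k)) (mvec R D) setT
  (Xs i) (@vrect R D)) => //.
move=> _ [_ [B mB <-] <-]; rewrite setTI; apply: sub_sigma_algebra.
exists (fun i' j => if i' == i then B j else setT).
  by move=> i' j; case: ifP.
apply/seteqP; split=> x /= h => [j|i' i'k j].
  by have := h i ik j; rewrite eqxx.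
by case: eqP => // ->; exact: h.
Qed.

(** The identity into the coarser sigma-algebra is the random element standing for the past: a
    function of the past is a function composed with it, as [expect_indepM] requires. *)
Let id_past k : measurable_fun setT (id : T -> g_sigma_algebraType (past k)).
Proof.
move=> _ A sA; rewrite setTI preimage_id.
by apply: smallest_sub sA => //; exact: sigma_algebra_measurable.
Qed.

Let expect_past_present (k : 'I_N) (f : mvec R D -> R)
    (h : g_sigma_algebraType (past k) -> R) :
  bounded_measurable f -> bounded_measurable h ->
  expect P (fun x => f (Xs k x) * h x) = expect P (f \o Xs k) * expect P h.
Proof.
move=> bf bh.
have mXk := random_vector_measurable (rvXs k).
pose X1 : {mfun T >-> mvec R D} := mfun_Sub (mem_set mXk).
pose X2 : {mfun T >-> g_sigma_algebraType (past k)} := mfun_Sub (mem_set (@id_past k)).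
apply: (@expect_indepM _ _ _ P _ _ _ _ X1 X2) => // A B mA mB.
rewrite setIC muleC; apply: (@indep_sigma _ _ _ P (past k) (present k)) => //.
- exact: past_present_indep.
- have mk : measurable_fun (setT : set (g_sigma_algebraType (present k)))
      (Xs k : _ -> mvec R D).
    apply: (@measurability _ _ (g_sigma_algebraType (present k)) (mvec R D) setT
      (Xs k) (@vrect R D)) => //.
    move=> _ [C rC <-]; rewrite setTI; apply: sub_sigma_algebra.
    by exists C.
  by rewrite -[X in _ X]setTI; exact: mk.
Qed.

Lemma measurable_deviation (J : finType) (y : J -> mvec R D -> R) (c : J -> R) (r : R) :
  (forall j, measurable_fun setT (y j)) ->
  measurable [set x | r <
    \sum_j (N%:R^-1 * \sum_(i < N) y j (Xs i x) - c j) ^+ 2].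
Proof.
move=> my; rewrite -[X in measurable X]setTI; apply: measurable_fun_ltr => //.
apply: measurable_sum => j; apply: measurable_funX; apply: measurable_funB => //.
apply: measurable_funM => //; apply: measurable_sum => i.
exact: (measurableT_comp (my j) (random_vector_measurable (rvXs i))).
Qed.

Section Bounded.
Variables (J : finType) (y : J -> mvec R D -> R) (L : R).
Hypothesis L_ge0 : 0 <= L.
Hypothesis y_meas : forall j, measurable_fun setT (y j).
Hypothesis y_le : forall v, \sum_j y j v ^+ 2 <= L ^+ 2.

Let m j := expect P (y j \o X).

Let l2y v : l2norm (y ^~ v) <= L. Proof. by rewrite l2norm_le. Qed.

Let bm_y j : bounded_measurable (y j).
Proof.
split=> //; exists L => v.
rewrite -(@ler_pXn2r _ 2%N)// ?nnegrE// real_normK ?num_real//.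
apply: le_trans (y_le v); rewrite (bigD1 j)//= lerDl.
by apply: sumr_ge0 => i _; exact: sqr_ge0.
Qed.

Let bm_comp (f : mvec R D -> R) (Z : T -> mvec R D) : random_vector Z ->
  bounded_measurable f -> bounded_measurable (f \o Z).
Proof.
move=> rZ [mf [M fM]]; split; last by exists M => x; exact: fM.
by apply: measurableT_comp => //; exact: random_vector_measurable.
Qed.

(** Testing the mean against itself: |m|^2 = E <m, y(X)> <= |m| L. *)
Let l2m : l2norm m <= L.
Proof.
have [m0|m_neq0] := eqVneq (l2norm m) 0; first by rewrite m0.
have m_gt0 : 0 < l2norm m by rewrite lt0r m_neq0 l2norm_ge0.
rewrite -(ler_pM2l m_gt0) -expr2 sqr_l2norm.
have int j : P.-integrable setT (fun x => (m j * y j (X x))%:E).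
  apply: integZ.
  by apply: (bounded_measurable_integrable P (f := y j \o X)); exact: bm_comp.
have -> : \sum_j m j ^+ 2 = expect P (fun x => \sum_j m j * y j (X x)).
  rewrite expect_sum//; apply: eq_bigr => j _; rewrite expectZ ?expr2//.
  by apply: (bounded_measurable_integrable P (f := y j \o X)); exact: bm_comp.
rewrite -[leRHS](expect_cst P); apply: expect_le.
- exact: integ_sum.
- exact/bounded_measurable_integrable/bounded_measurable_cst.
- move=> x; apply: le_trans (ler_dot _ _) _.
  by rewrite ler_wpM2l ?l2norm_ge0.
Qed.

(** Both [y] and its mean have norm at most [L], so 2L normalises the difference. For L = 0 the
    inverse is 0 by convention and [w] vanishes. *)
Let w j v := (2 * L)^-1 * (y j v - m j).

Let w_le1 v : \sum_j w j v ^+ 2 <= 1.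
Proof.
under eq_bigr do rewrite exprMn; rewrite -mulr_sumr.
have h : \sum_j (y j v - m j) ^+ 2 <= (2 * L) ^+ 2.
  rewrite -l2norm_le; last by rewrite mulr_ge0.
  apply: le_trans (l2normD _ (fun j => - m j)) _.
  have -> : l2norm (fun j => - m j) = l2norm m.
    by rewrite /l2norm; under eq_bigr do rewrite sqrrN.
  by have := l2y v; have := l2m; lra.
have [L0|L0] := eqVneq (2 * L) 0; first by rewrite L0 invr0 expr0n mul0r.
rewrite exprVn mulrC ler_pdivrMr ?mul1r//.
by rewrite exprn_gt0// lt0r L0 mulr_ge0.
Qed.

(** Undoing the normalisation also works for L = 0, where [y] and [m] are both zero. *)
Let wE j v : 2 * L * w j v = y j v - m j.
Proof.
have [L0|L0] := eqVneq L 0; last first.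
  by rewrite /w mulrA divff ?mul1r// mulf_neq0.
have z (f : J -> R) : l2norm f <= L -> f j = 0.
  move=> fL; have f0 : l2norm f = 0 by apply/eqP; rewrite eq_le l2norm_ge0 andbT -L0.
  have := sqr_l2norm f; rewrite f0 expr0n/= => /esym/eqP.
  rewrite psumr_eq0 => [/allP/(_ j (mem_index_enum _))|i _]; last exact: sqr_ge0.
  by rewrite sqrf_eq0 => /eqP.
by rewrite (z _ (l2y v)) (z _ l2m) L0 mulr0 mul0r subrr.
Qed.

Let bm_w j : bounded_measurable (w j).
Proof.
apply: bounded_measurableM; first exact: bounded_measurable_cst.
by apply: bounded_measurableD => //; exact: bounded_measurable_cst.
Qed.

Let expect_w j i : expect P (w j \o Xs i) = 0.
Proof.
rewrite (same_law_expect rvX)// /w.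
have int : P.-integrable setT (fun x => (y j (X x))%:E).
  by apply: (bounded_measurable_integrable P (f := y j \o X)); exact: bm_comp.
have intc (c : R) : P.-integrable setT (fun=> c%:E).
  exact: (bounded_measurable_integrable P (bounded_measurable_cst _ c)).
rewrite (_ : _ \o _ = fun x => (2 * L)^-1 * (y j (X x) + - m j))//.
rewrite expectZ; last exact: (integrableD measurableT int (intc (- m j))).
by rewrite expectD// expect_cst subrr mulr0.
Qed.

Lemma bounded_iid_hoeffding (t : R) : 0 <= t ->
  (P [set x | (64 * L ^+ 2 * (t + 1) / N%:R <
      \sum_j (N%:R^-1 * \sum_(i < N) y j (Xs i x) - m j) ^+ 2)%R] <=
    (expR (- t))%:E)%E.
Proof.
move=> t0; have NR : (0 : R) < N%:R by rewrite ltr0n.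
(* Increments are indexed by all naturals and copies by ['I_N]; beyond N the increments are zero. *)
pose W k j x := if insub k is Some i then w j (Xs i x) else 0.
(* This threshold gives the exponent 1/8 - (t + 1) <= -t; rescaling by (2L/N)^2 turns it into 64 L^2
   (t + 1) / N. *)
have := @vector_hoeffding _ _ _ P J N W past N_gt0 _ _ _ _ (16 * N%:R * (t + 1)).
have mw k j d' (T' : measurableType d') (Z : 'I_N -> T' -> mvec R D) :
    (forall i : 'I_N, i = k :> nat -> measurable_fun setT (Z i)) ->
    measurable_fun setT (fun x => if insub k is Some i then w j (Z i x) else 0).
  move=> mZ; case: insubP => [i _ ik|_]; last exact: measurable_cst.
  by apply: measurableT_comp; [exact: (bm_w j).1|exact: mZ].
set Q := (X in (_ -> _ -> _ -> _ -> (P X <= _)%E) -> _).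
have sQ : [set x | (64 * L ^+ 2 * (t + 1) / N%:R <
    \sum_j (N%:R^-1 * \sum_(i < N) y j (Xs i x) - m j) ^+ 2)%R] `<=` Q.
  move=> x /=; set sw := \sum_j (\sum_(i < N) W i j x) ^+ 2.
  have -> : \sum_j (N%:R^-1 * \sum_(i < N) y j (Xs i x) - m j) ^+ 2 =
      (2 * L / N%:R) ^+ 2 * sw.
    rewrite mulr_sumr; apply: eq_bigr => j _; rewrite -exprMn; congr (_ ^+ 2).
    have WE : 2 * L * \sum_(i < N) W i j x = \sum_(i < N) y j (Xs i x) - N%:R * m j.
      rewrite mulr_sumr.
      rewrite (eq_bigr (fun i : 'I_N => y j (Xs i x) - m j)) => [|i _]; last first.
        by rewrite /W valK wE.
      by rewrite big_split/= sumr_const card_ord mulNrn mulr_natl.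
    by rewrite mulrAC WE; field; lra.
  move=> lt; change (16 * N%:R * (t + 1) < sw); rewrite ltNge; apply/negP => le.
  move: lt; apply/negP; rewrite -leNgt.
  have -> : 64 * L ^+ 2 * (t + 1) / N%:R =
      (2 * L / N%:R) ^+ 2 * (16 * N%:R * (t + 1)) by field; lra.
  by apply: ler_wpM2l => //; exact: sqr_ge0.
have mQ : measurable Q.
  rewrite -[X in measurable X]setTI; apply: measurable_fun_ltr => //.
  apply: measurable_sum => j; apply: measurable_funX; apply: measurable_sum => i.
  by apply: mw => i' _; exact: random_vector_measurable.
move=> hoef; apply: (@le_trans _ _ (P Q)).
  apply: le_measure => //; rewrite inE//.
  exact: measurable_deviation.
apply: le_trans (hoef _ _ _ _) _.
- by move=> k j; apply: mw => i _; exact: random_vector_measurable.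
- move=> k x; rewrite /W; case: insubP => [i _ _|_]; first exact: w_le1.
  by rewrite big1// => j _; rewrite expr0n.
- move=> i k j ik; apply: mw => i' i'i; apply: Xs_past.
  by rewrite i'i.
- move=> k j h kN bh; rewrite /W insubT/=.
  by rewrite expect_past_present// expect_w mul0r.
rewrite lee_fin ler_expR.
have -> : 16 * N%:R * (t + 1) / (16 * N%:R) = t + 1 by field; lra.
lra.
Qed.

End Bounded.

Variables (J : finType) (y : J -> mvec R D -> R) (L : R).
Hypothesis L_ge0 : 0 <= L.
Hypothesis y_meas : forall j, measurable_fun setT (y j).
Hypothesis y_le : {ae P, forall x, \sum_j y j (X x) ^+ 2 <= L ^+ 2}.

Lemma iid_hoeffding (t : R) : 0 <= t ->
  (P [set x | (64 * L ^+ 2 * (t + 1) / N%:R <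
      \sum_j (N%:R^-1 * \sum_(i < N) y j (Xs i x) - expect P (y j \o X)) ^+ 2)%R]
    <= (expR (- t))%:E)%E.
Proof.
move=> t0.
pose G := [set v : mvec R D | \sum_j y j v ^+ 2 <= L ^+ 2].
have mG : measurable G.
  rewrite -[X in measurable X]setTI; apply: measurable_fun_le => //.
  by apply: measurable_sum => j; exact: measurable_funX.
(* Truncation turns the almost sure bound into a pointwise one. *)
pose z j v := y j v * \1_G v.
have zy j v : G v -> z j v = y j v by move=> Gv; rewrite /z indicE mem_set// mulr1.
have mz j : measurable_fun setT (z j).
  by apply: measurable_funM => //; exact: measurable_indic.
have z_le v : \sum_j z j v ^+ 2 <= L ^+ 2.
  have [Gv|nGv] := pselect (G v); first by under eq_bigr do rewrite zy//.
  by rewrite big1 ?sqr_ge0// => j _; rewrite /z indicE memNset// mulr0 expr0n.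
apply: le_trans (bounded_iid_hoeffding L_ge0 mz z_le t0).
have mcomp (f : mvec R D -> R) (Z : T -> mvec R D) : random_vector Z ->
    measurable_fun setT f -> measurable_fun setT (f \o Z).
  move=> rZ mf; apply: measurableT_comp => //; exact: random_vector_measurable.
have Ez j : expect P (z j \o X) = expect P (y j \o X).
  apply: expect_ae; try exact: mcomp.
  by apply: filterS y_le => x Gx; exact: zy.
have aeXs : {ae P, forall x, forall i, G (Xs i x)}.
  by apply: filter_forall => i; exact: (same_law_ae rvX).
rewrite le_eqVlt; apply/orP; left; apply/eqP.
(* Outside the null set [C] no copy is truncated, so the deviation events for [y] and [z] coincide
   there and have equal probability. *)
have [C [mC C0 nC]] := aeXs.
set A1 := (X in P X = _); set A2 := (X in _ = P X).
have eqD : A1 `\` C = A2 `\` C.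
  apply/seteqP; split=> x [Ax nCx]; split=> //; move: Ax; rewrite /A1 /A2 /=;
    have GXs i : G (Xs i x) by [apply: contrapT => nG; apply: nCx; apply: nC => /(_ i)];
    under eq_bigr do under eq_bigr do rewrite ?zy//.
  - by under [in X in _ -> X]eq_bigr do (under eq_bigr do rewrite zy//; rewrite Ez).
  - by under [in X in _ -> X]eq_bigr do rewrite -Ez.
have nullD B : measurable B -> P B = P (B `\` C).
  move=> mB; rewrite measureD//; last first.
    exact: le_lt_trans (probability_le1 P mB) (ltry 1).
  suff PBC : P (B `&` C) = 0%E by rewrite [X in (_ - X)%E]PBC sube0.
  apply/eqP; rewrite -measure_le0 -C0; apply: le_measure; rewrite ?inE//.
  exact: measurableI.
by rewrite nullD 1?[RHS]nullD ?eqD//; exact: measurable_deviation.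
Qed.

End IidHoeffding.

(** * Measurability of matrix functions *)

(* The pseudoinverse is discontinuous; it is measurable as the limit of its
   Tikhonov regularisations (M^T M + t)^-1 M^T when t tends to 0. *)
Section Tikhonov.
Variable R : realType.

Lemma sqr_frob_tr m n (M : 'M[R]_(m, n)) : frob M ^+ 2 = \tr (M^T *m M).
Proof.
rewrite sqr_frob exchange_big/=; apply: eq_bigr => j _.
by rewrite mxE; apply: eq_bigr => i _; rewrite mxE expr2.
Qed.

(** In the expansion of the square the cross terms are 2t |M Y|^2 >= 0. This gives invertibility of
    M^T M + t and the bound |t (M^T M + t)^-1 Z| <= |Z|. *)
Lemma frob_gramD_ge m n p (M : 'M[R]_(m, n)) (Y : 'M[R]_(n, p)) (t : R) : 0 <= t ->
  t * frob Y <= frob ((M^T *m M + t%:M) *m Y).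
Proof.
move=> t0; rewrite -(@ler_pXn2r _ 2%N)// ?nnegrE ?mulr_ge0 ?frob_ge0//.
rewrite exprMn mulmxDl mul_scalar_mx.
set G := M^T *m M *m Y.
have GG := sqr_ge0 (frob G); have MY := sqr_ge0 (frob (M *m Y)).
have trE : (G + t *: Y)^T = G^T + t *: Y^T by apply/matrixP => i j; rewrite !mxE.
rewrite [leRHS]sqr_frob_tr trE !(mulmxDl, mulmxDr) -!scalemxAl -!scalemxAr.
rewrite !mxtraceD !mxtraceZ -!sqr_frob_tr.
have -> : \tr (Y^T *m G) = frob (M *m Y) ^+ 2.
  by rewrite sqr_frob_tr trmx_mul /G !mulmxA.
have -> : \tr (G^T *m Y) = frob (M *m Y) ^+ 2.
  by rewrite sqr_frob_tr /G !trmx_mul trmxK !mulmxA.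
by have := sqr_ge0 t; nra.
Qed.

Lemma unitmx_gramD m n (M : 'M[R]_(m, n)) (t : R) : 0 < t ->
  M^T *m M + t%:M \in unitmx.
Proof.
move=> t0; set K := _ + _.
have symK : K^T = K by rewrite linearD/= trmx_mul trmxK tr_scalar_mx.
rewrite -row_free_unit -kermx_eq0; apply/eqP/trmx_inj; rewrite trmx0.
apply: frob_eq0; apply/eqP; rewrite eq_le frob_ge0 andbT.
rewrite -(ler_pM2l t0) mulr0; apply: le_trans (frob_gramD_ge M _ (ltW t0)) _.
have -> : (M^T *m M + t%:M) *m (kermx K)^T = 0.
  by rewrite -/K -{1}symK -trmx_mul mulmx_ker trmx0.
by rewrite /frob big1 ?sqrtr0// => i _; rewrite big1// => j _; rewrite mxE expr0n.
Qed.

Definition tikhonov m n (t : R) (M : 'M[R]_(m, n)) : 'M[R]_(n, m) :=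
  invmx (M^T *m M + t%:M) *m M^T.

(** With K = M^T M + t, the error is -t K^-1 N. Bounding K^-1 by 1/t would not make it small; but N
    = M^T M Z for Z = N N^T N, so K^-1 N = Z - t K^-1 Z has norm at most 2 |Z|. *)
Lemma frob_tikhonov m n (M : 'M[R]_(m, n)) (t : R) : 0 < t ->
  frob (tikhonov t M - mpinv M) <=
    t * (2 * frob (mpinv M *m (mpinv M)^T *m mpinv M)).
Proof.
move=> t0; have t0' := ltW t0; have [a b c d] := mpinvP M.
set N := mpinv M in a b c d *; set K := M^T *m M + t%:M.
have uK : K \in unitmx := unitmx_gramD M t0.
set Z := N *m N^T *m N.
have MtMN : M^T *m M *m N = M^T.
  by rewrite -mulmxA -c -trmx_mul a.
have GZ : M^T *m M *m Z = N.
  by rewrite /Z !mulmxA MtMN -trmx_mul d b.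
have KN : K *m N = M^T + t *: N by rewrite mulmxDl MtMN mul_scalar_mx.
have KZ : K *m Z = N + t *: Z by rewrite mulmxDl GZ mul_scalar_mx.
have -> : tikhonov t M - N = - (t *: (Z - t *: (invmx K *m Z))).
  have -> : Z - t *: (invmx K *m Z) = invmx K *m N.
    rewrite -[N](addrK (t *: Z)) -KZ mulmxBr mulKmx// scalemxAr.
    by rewrite scalemxAr.
  rewrite scalemxAr -[t *: N](addKr M^T) -KN mulmxDr mulmxN mulKmx//.
  by rewrite opprD opprK.
rewrite frobN.
have frobZ p q (r : R) (H : 'M[R]_(p, q)) : 0 <= r -> frob (r *: H) = r * frob H.
  move=> r0; rewrite /frob.
  under eq_bigr do under eq_bigr do rewrite mxE exprMn.
  under eq_bigr do rewrite -mulr_sumr.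
  by rewrite -mulr_sumr sqrtrM ?sqr_ge0// sqrtr_sqr ger0_norm.
rewrite frobZ//; apply: ler_wpM2l => //.
apply: le_trans (frobD _ _) _; rewrite frobN frobZ//.
have := frob_gramD_ge M (invmx K *m Z) t0'.
by rewrite -/K mulKVmx//; lra.
Qed.

Lemma tikhonov_cvg m n (M : 'M[R]_(m, n)) i j :
  tikhonov k.+1%:R^-1 M i j @[k --> \oo] --> mpinv M i j.
Proof.
set N := mpinv M; set c := 2 * frob (N *m N^T *m N).
apply/subr_cvg0/norm_cvg0P.
apply: (@squeeze_cvgr _ _ _ _ (fun=> 0) (fun k => k.+1%:R^-1 * c)).
- near=> k; rewrite normr_ge0/=.
  have tk : (0 : R) < k.+1%:R^-1 by rewrite invr_gt0 ltr0n.
  apply: le_trans (frob_tikhonov M tk).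
  set H := tikhonov _ M - _.
  have -> : tikhonov k.+1%:R^-1 M i j - N i j = H i j by rewrite !mxE.
  rewrite -(@ler_pXn2r _ 2%N)// ?nnegrE ?frob_ge0// real_normK ?num_real//.
  rewrite sqr_frob (bigD1 i)//= (bigD1 j)//= -addrA lerDl addr_ge0//.
    by apply: sumr_ge0 => k' _; exact: sqr_ge0.
  by apply: sumr_ge0 => k' _; apply: sumr_ge0 => k'' _; exact: sqr_ge0.
- exact: cvg_cst.
- rewrite -[X in _ --> X](mul0r c); apply: cvgM; [exact: cvg_harmonic|exact: cvg_cst].
Unshelve. all: by end_near. Qed.

End Tikhonov.

Section MeasurableMatrices.
Context d (T : measurableType d) (R : realType).

Lemma measurable_funVr (f : T -> R) : measurable_fun setT f ->
  measurable_fun setT (fun x => (f x)^-1).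
Proof.
move=> mf.
(* Squaring gives [powR] a nonnegative base; at a zero of [f] both sides are 0. *)
have -> : (fun x => (f x)^-1) = (fun x => f x * powR (f x ^+ 2) (- 1)).
  apply/funext => x; rewrite powR_inv1 ?sqr_ge0//.
  have [->|f0] := eqVneq (f x) 0; first by rewrite invr0 mul0r.
  by rewrite expr2 invfM mulrA divff// mul1r.
apply: measurable_funM => //; 
apply: (@measurableT_comp _ _ _ _ _ _ (@powR R ^~ (- 1)) _ (fun x => f x ^+ 2)) => //.
exact: measurable_funX.
Qed.

Definition measurable_mx m n (M : T -> 'M[R]_(m, n)) :=
  forall i j, measurable_fun setT (fun x => M x i j).

Lemma measurable_mx_cst m n (M : 'M[R]_(m, n)) : measurable_mx (fun=> M).
Proof. by move=> i j; exact: measurable_cst. Qed.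

Lemma measurable_mxM m n p (M : T -> 'M[R]_(m, n)) (N : T -> 'M[R]_(n, p)) :
  measurable_mx M -> measurable_mx N -> measurable_mx (fun x => M x *m N x).
Proof.
move=> mM mN i j; under eq_fun do rewrite mxE.
by apply: measurable_sum => k; exact: measurable_funM.
Qed.

Lemma measurable_mxD m n (M N : T -> 'M[R]_(m, n)) :
  measurable_mx M -> measurable_mx N -> measurable_mx (fun x => M x + N x).
Proof.
by move=> mM mN i j; under eq_fun do rewrite mxE; exact: measurable_funD.
Qed.

Lemma measurable_mxB m n (M N : T -> 'M[R]_(m, n)) :
  measurable_mx M -> measurable_mx N -> measurable_mx (fun x => M x - N x).
Proof.
by move=> mM mN i j; under eq_fun do rewrite !mxE; exact: measurable_funB.
Qed.

Lemma measurable_mxZ m n (f : T -> R) (M : T -> 'M[R]_(m, n)) :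
  measurable_fun setT f -> measurable_mx M -> measurable_mx (fun x => f x *: M x).
Proof.
by move=> mf mM i j; under eq_fun do rewrite !mxE; exact: measurable_funM.
Qed.

Lemma measurable_mx_tr m n (M : T -> 'M[R]_(m, n)) :
  measurable_mx M -> measurable_mx (fun x => (M x)^T).
Proof. by move=> mM i j; under eq_fun do rewrite mxE; exact: mM. Qed.

Lemma measurable_mx_sum (I : Type) (s : seq I) m n (M : I -> T -> 'M[R]_(m, n)) :
  (forall i, measurable_mx (M i)) ->
  measurable_mx (fun x => \sum_(i <- s) M i x).
Proof.
move=> mM i j; under eq_fun do rewrite summxE.
by apply: measurable_sum => k; exact: mM.
Qed.

Lemma measurable_det n (M : T -> 'M[R]_n) : measurable_mx M ->
  measurable_fun setT (fun x => \det (M x)).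
Proof.
move=> mM; apply: measurable_sum => s; apply: measurable_funM => //.
by apply: measurable_prod => i _; exact: mM.
Qed.

Lemma measurable_invmx n (M : T -> 'M[R]_n) : (forall x, M x \in unitmx) ->
  measurable_mx M -> measurable_mx (fun x => invmx (M x)).
Proof.
move=> uM mM.
have -> : (fun x => invmx (M x)) = (fun x => (\det (M x))^-1 *: \adj (M x)).
  by apply/funext => x; rewrite /invmx uM.
apply: measurable_mxZ.
  by apply: measurable_funVr; exact: measurable_det.
move=> i j; under eq_fun do rewrite mxE; apply: measurable_funM => //.
by apply: measurable_det => k l; under eq_fun do rewrite !mxE; exact: mM.
Qed.

Lemma measurable_mpinv m n (M : T -> 'M[R]_(m, n)) : measurable_mx M ->
  measurable_mx (fun x => mpinv (M x)).
Proof.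
move=> mM i j.
apply: (@measurable_fun_cvg _ _ _ _ (fun k x => tikhonov k.+1%:R^-1 (M x) i j)).
- move=> k; apply: (measurable_mxM _ (measurable_mx_tr mM)).
  apply: measurable_invmx.
    by move=> x; apply: unitmx_gramD; rewrite invr_gt0 ltr0n.
  apply: measurable_mxD; last exact: measurable_mx_cst.
  exact: measurable_mxM (measurable_mx_tr mM) mM.
- by move=> x _; exact: tikhonov_cvg.
Qed.

Lemma measurable_frob m n (M : T -> 'M[R]_(m, n)) : measurable_mx M ->
  measurable_fun setT (fun x => frob (M x)).
Proof.
move=> mM; apply: measurableT_comp.
  by apply: continuous_measurable_fun; exact: sqrt_continuous.
apply: measurable_sum => i; apply: measurable_sum => j.
by apply: measurable_funX; exact: mM.
Qed.

Lemma measurable_frob_le m n (M : T -> 'M[R]_(m, n)) (r : R) : measurable_mx M ->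
  measurable [set x | frob (M x) <= r].
Proof.
move=> mM; rewrite -[X in measurable X]setTI; apply: measurable_fun_le => //.
exact: measurable_frob.
Qed.

Lemma measurable_mx_rv D (X : T -> 'cV[R]_D) : random_vector X -> measurable_mx X.
Proof. by move=> rX i j; rewrite ord1; exact: rX. Qed.

Lemma measurable_sample_cov D N (Xs : 'I_N -> T -> 'cV[R]_D) :
  (forall i, random_vector (Xs i)) -> measurable_mx (sample_cov Xs).
Proof.
move=> rXs.
have mXs i := measurable_mx_rv (rXs i).
have mmean : measurable_mx (sample_mean Xs).
  by apply: measurable_mxZ => //; exact: measurable_mx_sum.
apply: measurable_mxZ => //; apply: measurable_mx_sum => i.
have mB := measurable_mxB (mXs i) mmean.
exact: measurable_mxM mB (measurable_mx_tr mB).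
Qed.

End MeasurableMatrices.

(** * Deviation of the sample covariance *)

Section UnionBound.
Context d (T : measurableType d) (R : realType) (P : probability T R).

Lemma ae_union_bound (I : finType) (S : set T) (B : I -> set T) (r : R) :
    measurable S -> (forall i, measurable (B i)) ->
    (forall i, P (B i) <= r%:E)%E ->
    {ae P, forall x, S x -> exists i, B i x} ->
  (P S <= (#|I|%:R * r)%:E)%E.
Proof.
move=> mS mB PB [C [mC C0 SC]].
pose U (s : seq I) := \big[setU/set0]_(i <- s) B i.
have mU s : measurable (U s) by exact: bigsetU_measurable.
have PU s : (P (U s) <= ((size s)%:R * r)%:E)%E.
  elim: s => [|i s IHs]; first by rewrite /U big_nil measure0 mul0r.
  rewrite /U big_cons; apply: le_trans (measureU2 _ _ _) _ => //; first exact: mU.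
  rewrite /= -natr1 mulrDl mul1r addrC EFinD.
  exact: leeD.
rewrite cardE; apply: le_trans (PU (enum I)).
have SU : S `<=` U (enum I) `|` C.
  move=> x Sx; have [[i Bi]|nB] := pselect (exists i, B i x).
    by left; rewrite /U -bigcup_seq; exists i => //=; rewrite mem_enum.
  by right; apply: SC => /(_ Sx).
apply: (@le_trans _ _ (P (U (enum I) `|` C))).
  by apply: le_measure => //; rewrite inE//; exact: measurableU.
apply: le_trans (measureU2 _ _ _) _ => //.
by rewrite [X in (_ + X)%E]C0 adde0.
Qed.

(** A probability space is not null. Used to see that constants bounding a norm almost surely are
    nonnegative. *)
Lemma ae_witness (Q : T -> Prop) : {ae P, forall x, Q x} -> exists x, Q x.
Proof.
move=> aeQ; apply: contrapT => nQ.
have : {ae P, forall x, False} by apply: filterS aeQ => x Qx; apply: nQ; exists x.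
move=> [C [mC C0 TC]]; have : P setT = 0%E.
  apply/eqP; rewrite -measure_le0 -C0; apply: le_measure; rewrite ?inE//.
  by move=> x _; apply: TC.
rewrite probability_setT => /eqP; rewrite eqe oner_eq0.
by [].
Qed.

End UnionBound.

Section SampleCovariance.
Context d (T : measurableType d) (R : realType) (P : probability T R).
Variables (D N : nat) (X : T -> 'cV[R]_D) (Xs : 'I_N -> T -> 'cV[R]_D).
Hypothesis N_gt0 : (0 < N)%N.
Hypothesis rvX : random_vector X.
Hypothesis subX : subgaussian P X.
Hypothesis rvXs : forall i, random_vector (Xs i).
Hypothesis lawXs : forall i, same_law P (Xs i) X.
Hypothesis indepXs : mutually_independent P Xs.

Let mu := meanv P X.
Let Sigma := covmx P X.
Let Xt := centered P X.
Let Z i x := Xs i x - mu.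

(** Centring at the sample mean makes the summands dependent. Centring at a deterministic [c]
    restores independence at the price of a rank-one term. *)
Lemma sample_cov_shift (c : 'cV[R]_D) x :
  let m := N%:R^-1 *: \sum_(i < N) (Xs i x - c) in
  sample_cov Xs x =
    N%:R^-1 *: \sum_(i < N) ((Xs i x - c) *m (Xs i x - c)^T) - m *m m^T.
Proof.
move=> m; have N0 : N%:R != 0 :> R by rewrite pnatr_eq0 -lt0n.
have smE : sample_mean Xs x = m + c.
  have cN : c *+ N = N%:R *: c by rewrite scaler_nat.
  rewrite /m sumrB sumr_const card_ord cN scalerBr scalerA mulVf//.
  by rewrite scale1r subrK.
have sumE : \sum_(i < N) (Xs i x - c) = N%:R *: m.
  by rewrite /m scalerA mulfV// scale1r.
clearbody m.
pose z i := Xs i x - c.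
have sumT : \sum_i (z i)^T = N%:R *: m^T by rewrite -linear_sum/= sumE linearZ.
have mN : (m *m m^T) *+ N = N%:R *: (m *m m^T) by rewrite scaler_nat.
rewrite /sample_cov smE.
rewrite (eq_bigr (fun i => z i *m (z i)^T - m *m (z i)^T -
    (z i *m m^T - m *m m^T))) => [|i _]; last first.
  have -> : Xs i x - (m + c) = z i - m by rewrite /z opprD addrA addrAC.
  by move: (z i) => w; rewrite linearB/= mulmxBr !mulmxBl.
rewrite !sumrB -mulmx_suml -mulmx_sumr sumT sumE sumr_const card_ord mN.
rewrite -scalemxAl -scalemxAr subrr subr0 scalerBr scalerA mulVf//.
by rewrite scale1r.
Qed.

Lemma integ_centered k : P.-integrable setT (fun x => (Xt x k 0)%:E).
Proof.
have -> : (fun x => (Xt x k 0)%:E) = (fun x => (X x k 0 + - mu k 0)%:E).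
  by apply/funext => x; rewrite !mxE.
apply: (integD (f := fun x => X x k 0) (subX.1 k)).
exact: (bounded_measurable_integrable P (bounded_measurable_cst _ _)).
Qed.

Lemma expect_centered k : expect P (fun x => Xt x k 0) = 0.
Proof.
have -> : (fun x => Xt x k 0) = (fun x => X x k 0 + - mu k 0).
  by apply/funext => x; rewrite !mxE.
rewrite expectD; [|exact: (subX.1 k)|]; last first.
  exact: (bounded_measurable_integrable P (bounded_measurable_cst _ _)).
by rewrite expect_cst /mu mxE subrr.
Qed.

Let mXt : measurable_mx Xt.
Proof.
exact: (@measurable_mxB _ _ _ _ _ X (fun=> mu) (measurable_mx_rv rvX)
  (@measurable_mx_cst _ _ _ _ _ mu)).
Qed.

(** The sub-Gaussian bound in the direction of the k-th basis vector, with a^2 <= K^2 e^(a^2/K^2),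
    gives finite second moments. *)
Lemma integ_sqr_centered k : P.-integrable setT (fun x => (Xt x k 0 ^+ 2)%:E).
Proof.
have [_ [K [K0 subK]]] := subX.
pose e : 'cV[R]_D := delta_mx k 0.
have v1 : vnorm2 e = 1.
  rewrite /vnorm2 (bigD1 k)//= big1 ?addr0 => [|i ik].
    by rewrite mxE !eqxx expr1n sqrtr1.
  by rewrite mxE (negbTE ik) expr0n.
have eX x : (e^T *m centered P X x) 0 0 = Xt x k 0 by rewrite trmx_delta -rowE mxE.
pose g x := expR (Xt x k 0 ^+ 2 / K ^+ 2).
have Eg : (\int[P]_x (g x)%:E <= 2%:E)%E.
  by have := subK _ v1; under eq_integral do rewrite eX.
have mg : measurable_fun setT g.
  apply: measurableT_comp => //; apply: measurable_funM => //.
  by apply: measurable_funX; exact: mXt.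
have intg : P.-integrable setT (fun x => (g x)%:E).
  apply/integrableP; split; first exact/measurable_EFinP.
  apply: le_lt_trans (ltry 2); apply: le_trans Eg.
  by apply: ge0_le_integral => //=; [exact/measurable_EFinP/measurableT_comp
    |exact/measurable_EFinP|move=> x _; rewrite lee_fin ger0_norm// expR_ge0].
apply: (le_integrable _ _ _ (integZ (K ^+ 2) intg)) => //.
  by apply/measurable_EFinP; apply: measurable_funX; exact: mXt.
move=> x _; rewrite lee_fin !ger0_norm ?sqr_ge0 ?mulr_ge0 ?sqr_ge0 ?expR_ge0 ?(ltW K0)//.
rewrite mulrC -ler_pdivrMr ?exprn_gt0//.
by apply: le_trans (expR_ge1Dx _); rewrite lerDr.
Qed.

Lemma integ_centeredM k l : P.-integrable setT (fun x => (Xt x k 0 * Xt x l 0)%:E).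
Proof.
apply: (le_integrable _ _ _
  (integD (integ_sqr_centered k) (integ_sqr_centered l))) => //.
  by apply/measurable_EFinP; apply: measurable_funM; exact: mXt.
move=> x _; rewrite lee_fin [leRHS]ger0_norm ?addr_ge0 ?sqr_ge0//.
rewrite ler_norml; set a := Xt x k 0; set b := Xt x l 0.
by apply/andP; split; nra.
Qed.

Lemma covmx_bilinear m n (A : 'M[R]_(m, D)) (B : 'M[R]_(n, D)) p q :
  expect P (fun x => (A *m Xt x) p 0 * (B *m Xt x) q 0) = (A *m Sigma *m B^T) p q.
Proof.
have int k l : P.-integrable setT
    (fun x => (A p k * B q l * (Xt x k 0 * Xt x l 0))%:E).
  exact: integZ (integ_centeredM k l).
have -> : (fun x => (A *m Xt x) p 0 * (B *m Xt x) q 0) =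
    (fun x => \sum_l \sum_k A p k * B q l * (Xt x k 0 * Xt x l 0)).
  apply/funext => x; rewrite !mxE mulr_sumr; apply: eq_bigr => l _.
  by rewrite mulr_suml; apply: eq_bigr => k _; rewrite mulrACA.
rewrite expect_sum => [|l]; last exact: integ_sum.
rewrite mxE; apply: eq_bigr => l _; rewrite expect_sum// !mxE mulr_suml.
apply: eq_bigr => k _; rewrite expectZ; last exact: integ_centeredM.
by rewrite mulrAC [Sigma k l]mxE.
Qed.

Lemma psd_covmx : psd Sigma.
Proof.
split=> [|v].
  by apply/matrixP => i j; rewrite !mxE; congr expect; apply/funext => x; rewrite mulrC.
rewrite -[v in _ *m _ *m v]trmxK -covmx_bilinear.
by apply: Rintegral_ge0 => x _; rewrite -expr2 sqr_ge0.
Qed.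

Let mlin m (A : 'M[R]_(m, D)) : measurable_mx (fun v : mvec R D => A *m (v - mu)).
Proof.
apply: measurable_mxM; first exact: measurable_mx_cst.
apply: measurable_mxB; last exact: measurable_mx_cst.
by move=> i j; rewrite ord1; exact: measurable_coord.
Qed.

(** With Q = 1 - Pi, the vector Q (X - mu) has covariance Q Sigma Q^T = 0, so its squared
    coordinates integrate to 0 and vanish almost surely; equality in law transfers this to the
    copies. *)
Lemma centered_range :
  {ae P, forall x, forall i, Sigma *m mpinv Sigma *m Z i x = Z i x}.
Proof.
have [a b c e] := mpinvP Sigma.
pose Q := 1%:M - Sigma *m mpinv Sigma.
have QX k : {ae P, forall x, (Q *m (X x - mu)) k 0 = 0}.
  have : expect P (fun x => (Q *m Xt x) k 0 * (Q *m Xt x) k 0) = 0.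
    by rewrite covmx_bilinear mulmxBl mul1mx a subrr mul0mx mxE.
  pose f x := (Q *m Xt x) k 0 * (Q *m Xt x) k 0.
  have mQ := measurable_mxM (@measurable_mx_cst _ _ _ _ _ Q) mXt.
  have mf : measurable_fun setT f by apply: measurable_funM; exact: mQ.
  move=> Ef0; have : (\int[P]_x (f x)%:E = 0)%E.
    have fi : (\int[P]_x (f x)%:E)%E \is a fin_num.
      apply: integrable_fin_num => //.
      have -> : (fun x => (f x)%:E) = (fun x =>
          (\sum_l \sum_k' Q k k' * Q k l * (Xt x k' 0 * Xt x l 0))%:E).
        apply/funext => x; congr EFin; rewrite /f !mxE mulr_sumr; apply: eq_bigr => l _.
        by rewrite mulr_suml; apply: eq_bigr => k' _; rewrite mulrACA.
      apply: integ_sum => l; apply: integ_sum => k'; apply: integZ.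
      exact: integ_centeredM.
    by rewrite -(fineK fi) [fine _]Ef0.
  have f0 x : 0 <= f x by rewrite /f -expr2 sqr_ge0.
  move=> If0; have : (\int[P]_x `|(f x)%:E| = 0)%E.
    by rewrite -[RHS]If0; apply: eq_integral => x _; rewrite gee0_abs ?lee_fin.
  have mfE : measurable_fun setT (fun x => (f x)%:E) by apply/measurable_EFinP.
  move/(ae_eq_integral_abs P measurableT mfE); apply: filterS => x /(_ I).
  by move=> [] /eqP; rewrite mulf_eq0 orbb => /eqP.
have QXs : {ae P, forall x, forall i k, (Q *m (Xs i x - mu)) k 0 = 0}.
  apply: filter_forall => i; apply: filter_forall => k.
  apply: (same_law_ae (Q := [set v | (Q *m (v - mu)) k 0 = 0])
    rvX (rvXs i) (lawXs i)) => //.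
  rewrite -[X in measurable X]setTI.
  exact: (mlin Q k 0 measurableT (measurable_set1 0)).
  exact: QX.
apply: filterS QXs => x Qx i; apply/esym/eqP; rewrite -subr_eq0; apply/eqP.
rewrite -[X in X - _]mul1mx -mulmxBl; apply/matrixP => k j.
by rewrite ord1 Qx mxE.
Qed.

Lemma sample_cov_range : {ae P, forall x,
  Sigma *m mpinv Sigma *m sample_cov Xs x *m (Sigma *m mpinv Sigma) = sample_cov Xs x}.
Proof.
apply: filterS centered_range => x PiZ.
have [_ _ symPi _] := mpinvP Sigma; set Pi := Sigma *m mpinv Sigma in PiZ symPi *.
have PiS : Pi *m sample_cov Xs x = sample_cov Xs x.
  rewrite (sample_cov_shift mu) mulmxBr mulmxA -!scalemxAr !mulmx_sumr.
  have E1 : \sum_i Pi *m (Z i x *m (Z i x)^T) = \sum_i Z i x *m (Z i x)^T.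
    by apply: eq_bigr => i _; rewrite mulmxA PiZ.
  have E2 : \sum_i Pi *m Z i x = \sum_i Z i x by apply: eq_bigr => i _; rewrite PiZ.
  by rewrite [X in _ *: X - _]E1 [X in _ - _ *: X *m _]E2.
have symS : (sample_cov Xs x)^T = sample_cov Xs x.
  rewrite /sample_cov linearZ/= linear_sum; congr (_ *: _).
  by apply: eq_bigr => i _; rewrite /= trmx_mul trmxK.
by rewrite PiS -[LHS]trmxK trmx_mul symS symPi PiS.
Qed.

Section Concentration.
Variables (d1 d2 : nat) (A : 'M[R]_(d1, D)) (B : 'M[R]_(d2, D)) (CA CB : R).
Hypothesis A_le : {ae P, forall x, vnorm2 (A *m Xt x) <= CA}.
Hypothesis B_le : {ae P, forall x, vnorm2 (B *m Xt x) <= CB}.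

Lemma cov_deviation_measurable r :
  measurable [set x | frob (A *m (sample_cov Xs x - Sigma) *m B^T) <= r].
Proof.
apply: measurable_frob_le; apply: measurable_mxM; last exact: measurable_mx_cst.
apply: measurable_mxM; first exact: measurable_mx_cst.
apply: measurable_mxB; last exact: measurable_mx_cst.
exact: measurable_sample_cov.
Qed.

Lemma cov_deviation (u : R) : 0 < u ->
  (P (~` [set x | (frob (A *m (sample_cov Xs x - Sigma) *m B^T)
      <= 32 * CA * CB * Num.sqrt ((1 + u) / N%:R))%R]) <= (expR (- u))%:E)%E.
Proof.
move=> u0; set s := Num.sqrt _.
have NR : (0 : R) < N%:R by rewrite ltr0n.
have NR0 := ltW NR.
have CA0 : 0 <= CA by have [x] := ae_witness A_le; apply: le_trans (vnorm2_ge0 _).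
have CB0 : 0 <= CB by have [x] := ae_witness B_le; apply: le_trans (vnorm2_ge0 _).
have s0 : 0 <= s := sqrtr_ge0 _.
have sE : s ^+ 2 = (1 + u) / N%:R.
  by rewrite sqr_sqrtr// divr_ge0// ltW//; lra.
(* Origin of 16: the inequality is used at t = u + 1, and 64 (u + 2) <= 256 (1 + u). *)
have dev L : 0 <= L -> 64 * L ^+ 2 * (u + 1 + 1) / N%:R <= (16 * L * s) ^+ 2.
  move=> L0.
  have -> : (16 * L * s) ^+ 2 = 256 * L ^+ 2 * (1 + u) / N%:R.
    by rewrite exprMn sE exprMn; ring.
  rewrite ler_wpM2r ?invr_ge0//.
  by have := sqr_ge0 L; nra.
pose y (p : 'I_d1 * 'I_d2) (v : mvec R D) :=
  (A *m (v - mu)) p.1 0 * (B *m (v - mu)) p.2 0.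
pose z (q : 'I_d2) (v : mvec R D) := (B *m (v - mu)) q 0.
have my p : measurable_fun setT (y p) by apply: measurable_funM; exact: mlin.
have mz q : measurable_fun setT (z q) by exact: mlin.
have y_le : {ae P, forall x, \sum_p y p (X x) ^+ 2 <= (CA * CB) ^+ 2}.
  apply: filterS2 A_le B_le => x Ax Bx.
  have -> : \sum_p y p (X x) ^+ 2 = (vnorm2 (A *m Xt x) * vnorm2 (B *m Xt x)) ^+ 2.
    rewrite -frob_outer frobE sqr_l2norm; apply: eq_bigr => p _.
    by rewrite mxE big_ord1 [(_^T) _ _]mxE.
  by rewrite ler_pXn2r// ?nnegrE ?mulr_ge0 ?vnorm2_ge0// ler_pM ?vnorm2_ge0.
have z_le : {ae P, forall x, \sum_q z q (X x) ^+ 2 <= CB ^+ 2}.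
  by apply: filterS B_le => x; rewrite vnorm2E l2norm_le.
have u1 : 0 <= u + 1 by lra.
have := iid_hoeffding N_gt0 rvX rvXs lawXs indepXs (mulr_ge0 CA0 CB0) my y_le u1.
have := iid_hoeffding N_gt0 rvX rvXs lawXs indepXs CB0 mz z_le u1.
set badz := [set x | _]; set bady := [set x | _] => Pz Py.
have mbadz : measurable badz by exact: measurable_deviation.
have mbady : measurable bady by exact: measurable_deviation.
have AXs : {ae P, forall x, forall i, vnorm2 (A *m Z i x) <= CA}.
  apply: filter_forall => i.
  apply: (same_law_ae (Q := [set v | vnorm2 (A *m (v - mu)) <= CA])
    rvX (rvXs i) (lawXs i)) => //.
  rewrite [X in measurable X](_ : _ =
      [set v | \sum_p (A *m (v - mu)) p 0 ^+ 2 <= CA ^+ 2]).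
    rewrite -[X in measurable X]setTI; apply: measurable_fun_le => //.
    by apply: measurable_sum => p; apply: measurable_funX; exact: mlin.
  by apply/seteqP; split=> v /=; rewrite vnorm2E l2norm_le.
apply: le_trans (ae_union_bound (B := fun b : bool => if b then badz else bady)
  (r := expR (- (u + 1))) _ _ _ _) _.
- by apply: measurableC; exact: cov_deviation_measurable.
- by case.
- by case.
- apply: filterS AXs => x AZ; apply: contra_notP => nbad.
  have nz : ~ badz x by move=> h; apply: nbad; exists true.
  have ny : ~ bady x by move=> h; apply: nbad; exists false.
  move: nz ny; rewrite /badz /bady /= => /negP + /negP; rewrite -!leNgt => dz dy.
  have {}dz := le_trans dz (dev _ CB0).
  have {}dy := le_trans dy (dev _ (mulr_ge0 CA0 CB0)).
  pose m := N%:R^-1 *: \sum_(i < N) Z i x.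
  pose M := N%:R^-1 *: \sum_(i < N) (A *m Z i x) *m (B *m Z i x)^T - A *m Sigma *m B^T.
  have -> : A *m (sample_cov Xs x - Sigma) *m B^T = M - (A *m m) *m (B *m m)^T.
    rewrite (sample_cov_shift mu) -/m.
    rewrite !mulmxBr !mulmxBl addrAC -scalemxAr -scalemxAl mulmx_sumr mulmx_suml.
    rewrite trmx_mul !mulmxA; congr (_ *: _ - _ - _).
    by apply: eq_bigr => i _; rewrite trmx_mul !mulmxA.
  have frobM : frob M <= 16 * (CA * CB) * s.
    rewrite frobE l2norm_le ?mulr_ge0//; apply: le_trans dy.
    rewrite le_eqVlt; apply/orP; left; apply/eqP; apply: eq_bigr => p _.
    rewrite !mxE summxE covmx_bilinear.
    congr ((_ * _ - _) ^+ 2); last by rewrite [RHS]mxE.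
    by apply: eq_bigr => i _; rewrite mxE big_ord1 [(_^T) _ _]mxE.
  have Bm : vnorm2 (B *m m) <= 16 * CB * s.
    rewrite vnorm2E l2norm_le ?mulr_ge0//; apply: le_trans dz.
    rewrite le_eqVlt; apply/orP; left; apply/eqP; apply: eq_bigr => q _.
    have -> : expect P (z q \o X) = 0.
      have -> : z q \o X = fun x => \sum_k B q k * Xt x k 0.
        by apply/funext => x'; rewrite /z /= mxE.
      rewrite expect_sum => [|k]; last exact: integZ (integ_centered k).
      rewrite big1// => k _; rewrite expectZ; last exact: integ_centered.
      by rewrite expect_centered mulr0.
    rewrite subr0 /m -scalemxAr mxE mulmx_sumr summxE.
    by congr ((_ * _) ^+ 2).
  (* The triangle inequality suffices here: the decay in N comes from [B *m m], and 16 + 16 gives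
     the constant 32. *)
  have Am : vnorm2 (A *m m) <= CA.
    have step (r : seq 'I_N) : vnorm2 (A *m \sum_(i <- r) Z i x) <= (size r)%:R * CA.
      elim: r => [|i r IHr].
        rewrite big_nil mulmx0 /vnorm2 big1 ?sqrtr0 ?mul0r// => k _.
        by rewrite mxE expr0n.
      rewrite big_cons mulmxDr.
      have -> : (size (i :: r))%:R * CA = CA + (size r)%:R * CA.
        by rewrite /= -natr1 mulrDl mul1r addrC.
      apply: le_trans (lerD (AZ i) IHr).
      exact: vnorm2D.
    have := step (index_enum 'I_N); rewrite -[X in X%:R]/(size (index_enum 'I_N)).
    have -> : size (index_enum 'I_N) = N.
      by rewrite /index_enum -enumT size_enum_ord.
    move=> le; rewrite -(ler_pM2l NR); apply: le_trans le.
    rewrite /m -scalemxAr vnorm2E /l2norm.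
    under eq_bigr do rewrite mxE exprMn.
    rewrite -mulr_sumr sqrtrM ?sqr_ge0// sqrtr_sqr ger0_norm ?invr_ge0//.
    by rewrite mulrA mulfV ?gt_eqF// mul1r.
  apply: le_trans (frobD _ _) _; rewrite frobN frob_outer.
  have : vnorm2 (A *m m) * vnorm2 (B *m m) <= CA * (16 * CB * s).
    by apply: ler_pM; rewrite ?vnorm2_ge0.
  by lra.
(* Two bad events of probability at most e^(-u-1) each, and 2 <= e. *)
rewrite card_bool lee_fin opprD expRD mulrC -mulrA.
apply: ler_piMr; first exact: expR_ge0.
rewrite expRN mulrC ler_pdivrMr ?expR_gt0// mul1r.
by have := expR_ge1Dx (1 : R); lra.
Qed.

End Concentration.

(** * Deviation of the pseudoinverse of the sample covariance *)

Section Precision.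
Variables (d1 d2 : nat) (A : 'M[R]_(d1, D)) (B : 'M[R]_(d2, D)) (CA CB Theta : R).
Let Sd := mpinv Sigma.
Let S := psd_sqrt Sd.

Lemma precision_deviation_measurable r :
  measurable [set x | frob (A *m (mpinv (sample_cov Xs x) - Sd) *m B^T) <= r].
Proof.
apply: measurable_frob_le; apply: measurable_mxM; last exact: measurable_mx_cst.
apply: measurable_mxM; first exact: measurable_mx_cst.
apply: measurable_mxB; last exact: measurable_mx_cst.
by apply: measurable_mpinv; exact: measurable_sample_cov.
Qed.

Hypothesis A_le : {ae P, forall x, vnorm2 (A *m Sd *m Xt x) <= CA}.
Hypothesis B_le : {ae P, forall x, vnorm2 (B *m Sd *m Xt x) <= CB}.
Hypothesis S_le : {ae P, forall x, vnorm2 (S *m Xt x) ^+ 2 <= Theta}.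

Lemma precision_deviation (u : R) : 0 < u ->
  128 ^+ 2 * (1 + u) * Theta ^+ 2 < N%:R ->
  (P (~` [set x | (frob (A *m (mpinv (sample_cov Xs x) - Sd) *m B^T)
      <= 128 * CA * CB * Num.sqrt ((1 + u) / N%:R))%R]) <= (expR (- u))%:E)%E.
Proof.
move=> u0 NTheta; set s := Num.sqrt _.
have NR : (0 : R) < N%:R by rewrite ltr0n.
have NR0 := ltW NR.
have CA0 : 0 <= CA by have [x] := ae_witness A_le; apply: le_trans (vnorm2_ge0 _).
have CB0 : 0 <= CB by have [x] := ae_witness B_le; apply: le_trans (vnorm2_ge0 _).
have Th0 : 0 <= Theta by have [x] := ae_witness S_le; apply: le_trans (sqr_ge0 _).
pose th := Num.sqrt Theta.
(* [Theta] bounds a squared norm, while [cov_deviation] takes bounds on norms. *)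
have th0 : 0 <= th := sqrtr_ge0 _.
have thE : th ^+ 2 = Theta by rewrite sqr_sqrtr.
have S_le' : {ae P, forall x, vnorm2 (S *m Xt x) <= th}.
  by apply: filterS S_le => x; rewrite -thE ler_pXn2r// nnegrE ?vnorm2_ge0.
have s0 : 0 <= s := sqrtr_ge0 _.
have sE : s ^+ 2 = (1 + u) / N%:R.
  by rewrite sqr_sqrtr// divr_ge0// ltW//; lra.
(* The condition on N is exactly this inequality, squared. It gives 64 Theta s <= 1/2, the smallness
   required for inverting K. *)
have Ths : Theta * s <= 128^-1.
  rewrite -(@ler_pXn2r _ 2%N)// ?nnegrE ?mulr_ge0// exprMn sE mulrA.
  rewrite ler_pdivrMr// exprVn [leRHS]mulrC ler_pdivlMr ?exprn_gt0//.
  by move: NTheta; lra.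
have u3 : 0 < u + 3 by lra.
(* Raising u to u + 3 at most doubles the root, as 4 + u <= 4 (1 + u); the constant 32 becomes
   64. *)
have s3 : Num.sqrt ((1 + (u + 3)) / N%:R) <= 2 * s.
  rewrite -(@ler_pXn2r _ 2%N)// ?nnegrE ?sqrtr_ge0 ?mulr_ge0//.
  rewrite exprMn sE sqr_sqrtr; last by rewrite divr_ge0//; lra.
  by rewrite [leRHS]mulrA ler_wpM2r ?invr_ge0//; lra.
have dev m n (M : 'M[R]_(m, D)) (M' : 'M[R]_(n, D)) (c c' : R) x : 0 <= c -> 0 <= c' ->
    [set x | frob (M *m (sample_cov Xs x - Sigma) *m M'^T)
      <= 32 * c * c' * Num.sqrt ((1 + (u + 3)) / N%:R)] x ->
    frob (M *m (sample_cov Xs x - Sigma) *m M'^T) <= 64 * (c * c') * s.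
  move=> c0 c'0 /= h; apply: le_trans h _.
  by have := ler_wpM2l (mulr_ge0 c0 c'0) s3; lra.
have PAB := cov_deviation A_le B_le u3.
have PAS := cov_deviation A_le S_le' u3.
have PSB := cov_deviation S_le' B_le u3.
have PSS := cov_deviation S_le' S_le' u3.
pose s' := Num.sqrt ((1 + (u + 3)) / N%:R).
have mdev m n (M : 'M[R]_(m, D)) (M' : 'M[R]_(n, D)) (r : R) :=
  measurableC (cov_deviation_measurable M M' r).
have mAB := mdev _ _ (A *m Sd) (B *m Sd) (32 * CA * CB * s').
have mAS := mdev _ _ (A *m Sd) S (32 * CA * th * s').
have mSB := mdev _ _ S (B *m Sd) (32 * th * CB * s').
have mSS := mdev _ _ S S (32 * th * th * s').
set badAB := ~` _ in PAB mAB; set badAS := ~` _ in PAS mAS.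
set badSB := ~` _ in PSB mSB; set badSS := ~` _ in PSS mSS.
apply: le_trans (ae_union_bound (B := fun b : bool * bool =>
    if b.1 then if b.2 then badAB else badAS else if b.2 then badSB else badSS)
  (r := expR (- (u + 3))) _ _ _ _) _.
- by apply: measurableC; exact: precision_deviation_measurable.
- by move=> [[] []].
- by move=> [[] []].
- apply: filterS sample_cov_range => x ShatPi; apply: contra_notP => nbad.
  have /contrapT/(dev _ _ _ _ _ _ _ CA0 CB0) xAB : ~ badAB x.
    by move=> h; apply: nbad; exists (true, true).
  have /contrapT/(dev _ _ _ _ _ _ _ CA0 th0) xAS : ~ badAS x.
    by move=> h; apply: nbad; exists (true, false).
  have /contrapT/(dev _ _ _ _ _ _ _ th0 CB0) xSB : ~ badSB x.
    by move=> h; apply: nbad; exists (false, true).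
  have /contrapT/(dev _ _ _ _ _ _ _ th0 th0) xSS : ~ badSS x.
    by move=> h; apply: nbad; exists (false, false).
  have [symS _ _ _ _] := psd_sqrt_mpinv_range psd_covmx.
  have small : frob (S *m (sample_cov Xs x - Sigma) *m S) <= 2^-1.
    rewrite -[X in _ *m X]symS; apply: le_trans xSS _.
    by rewrite -expr2 thE -mulrA; lra.
  apply: le_trans (frob_mpinvB psd_covmx ShatPi small A B) _.
  set e1 := frob (_ *m _^T) in xAB *; set e2 := frob (_ *m S^T) in xAS *.
  set e3 := frob (S *m _ *m _) in xSB *.
  have e20 : 0 <= e2 := frob_ge0 _; have e30 : 0 <= e3 := frob_ge0 _.
  have e23 : e2 * e3 <= (64 * (CA * th) * s) * (64 * (th * CB) * s) by exact: ler_pM.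
  have -> : 128 * CA * CB * s = 64 * (CA * CB) * s + 64 * (CA * CB) * s by lra.
  rewrite -mulrA; apply: lerD => //.
  (* The quadratic term is at most 2 * 64 * 64 / 128 = 64 times [CA * CB * s], as much as the linear
     one; together they make 128. *)
  have E : (64 * (CA * th) * s) * (64 * (th * CB) * s) =
    64 * (64 * (CA * CB * s * (Theta * s))) by rewrite -thE; ring.
  have k0 : 0 <= CA * CB * s by apply: mulr_ge0 => //; exact: mulr_ge0.
  have := ler_wpM2l k0 Ths; lra.
(* Four bad events of probability at most e^(-u-3) each, and 4 <= e^3. *)
rewrite card_prod card_bool lee_fin opprD expRD mulrC -mulrA.
apply: ler_piMr; first exact: expR_ge0.
rewrite expRN mulrC ler_pdivrMr ?expR_gt0// mul1r.
by have := expR_ge1Dx (3 : R); lra.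
Qed.

End Precision.

End SampleCovariance.

Theorem theorem2 :
  exists C1 C2 : nat, (0 < C1)%N /\ (0 < C2)%N /\
  forall (R : realType) (dT : measure_display) (T : measurableType dT)
    (P : probability T R) (D d1 d2 N : nat)
    (X : T -> 'cV[R]_D) (Xs : 'I_N -> T -> 'cV[R]_D)
    (A : 'M[R]_(d1, D)) (B : 'M[R]_(d2, D)),
    (0 < N)%N ->
    random_vector X -> subgaussian P X ->
    (forall i, random_vector (Xs i)) ->
    (forall i, same_law P (Xs i) X) ->
    mutually_independent P Xs ->
    let Sigma := covmx P X in
    let Xt := centered P X in
    (* (i) *)
    (forall CA CB : R,
      {ae P, forall x, vnorm2 (A *m Xt x) <= CA} ->
      {ae P, forall x, vnorm2 (B *m Xt x) <= CB} ->
      forall u : R, 0 < u ->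
        (P [set x | (frob (A *m (sample_cov Xs x - Sigma) *m B^T)
                     <= C1%:R * CA * CB * Num.sqrt ((1 + u) / N%:R))%R]
          >= (1 - expR (- u))%:E)%E)
    /\
    (* (ii) *)
    (forall CAd CBd Theta : R,
      {ae P, forall x, vnorm2 (A *m mpinv Sigma *m Xt x) <= CAd} ->
      {ae P, forall x, vnorm2 (B *m mpinv Sigma *m Xt x) <= CBd} ->
      {ae P, forall x, vnorm2 (psd_sqrt (mpinv Sigma) *m Xt x) ^+ 2 <= Theta} ->
      forall u : R, 0 < u ->
        N%:R > C2%:R * (1 + u) * Theta ^+ 2 ->
        (P [set x | (frob (A *m (mpinv (sample_cov Xs x) - mpinv Sigma) *m B^T)
                     <= C1%:R * CAd * CBd * Num.sqrt ((1 + u) / N%:R))%R]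
          >= (1 - expR (- u))%:E)%E).
Proof.
(* Both parts share the first constant, so the 32 obtained in (i) is enlarged to the 128 of (ii). *)
exists 128%N, (128 ^ 2)%N; split=> //; split; first by rewrite expn_gt0.
move=> R dT T P D d1 d2 N X Xs A B N_gt0 rvX subX rvXs lawXs indepXs Sigma Xt.
split=> [CA CB A_le B_le u u0|CAd CBd Theta A_le B_le S_le u u0 NTheta].
- have mdev := cov_deviation_measurable P X rvXs A B.
  apply: (@le_trans _ _ (P [set x | (frob (A *m (sample_cov Xs x - Sigma) *m B^T)
      <= 32 * CA * CB * Num.sqrt ((1 + u) / N%:R))%R])).
    apply: probability_setC_ge; first exact: mdev.
    exact: cov_deviation.
  apply: le_measure; rewrite ?inE; [exact: mdev|exact: mdev|].
  move=> x /= /le_trans; apply.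
  have [y yA] := ae_witness A_le; have [z zB] := ae_witness B_le.
  have CA0 := le_trans (vnorm2_ge0 _) yA; have CB0 := le_trans (vnorm2_ge0 _) zB.
  by rewrite !ler_wpM2r ?sqrtr_ge0// ler_nat.
- apply: probability_setC_ge.
    exact: precision_deviation_measurable.
  apply: (precision_deviation N_gt0 rvX subX rvXs lawXs indepXs A_le B_le S_le u0).
  by move: NTheta; rewrite natrX.
Qed.
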